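(* Let $n\in\mathbb N$ and let $H$ be a real or complex Hilbert space with $\dim H\geq n$. Suppose $\phi:P_n(H)\to P_n(H)$ is a map (not assumed surjective or injective) such that $\angle(\phi(P),\phi(Q))=\angle(P,Q)$ for all $P,Q\in P_n(H)$. If $n=1$ or $n\neq \dim H/2$, then there exists a linear or conjugate-linear isometry $V$ on $H$ such that $\phi(P)=VPV^*$ for all $P\in P_n(H)$. Moreover, if $H$ is infinite dimensional and $\phi:P_\infty(H)\to P_\infty(H)$ is a surjective map with $\angle(\phi(P),\phi(Q))=\angle(P,Q)$ for all $P,Q\in P_\infty(H)$, then there exists a unitary or antiunitary operator $U$ on $H$ such that $\phi(P)=UPU^*$ for all $P\in P_\infty(H)$.
   Context: A projection means a self-adjoint idempotent bounded operator on $H$. $P_n(H)$ denotes the set of all rank-$n$ projections on $H$, and $P_\infty(H)$ the set of all projections of infinite rank. For projections $P,Q,P',Q'$ on $H$, ''$\angle(P,Q)=\angle(P',Q')$'' (equality of principal angles) means by definition that the positive operators $QPQ$ and $Q'P'Q'$ are unitarily equivalent (orthogonally equivalent in the real case); for finite rank projections this is the same as equality, with multiplicities, of the eigenvalues of $QPQ$ and $Q'P'Q'$ (whose square roots are the cosines of the principal angles). For a conjugate-linear operator $V$, $V^*$ denotes the conjugate-linear operator with $\langle Vx,y\rangle=\overline{\langle x,V^*y\rangle}$ for all $x,y$; an isometry means $\|Vx\|=\|x\|$ for all $x$. *)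

(* Defs.v *)
From mathcomp Require Import all_boot all_order all_algebra.
From mathcomp Require Import reals complex.
Set Implicit Arguments. Unset Strict Implicit. Unset Printing Implicit Defensive.
Import Order.TTheory GRing.Theory Num.Theory.
Local Open Scope ring_scope.

Definition scal (R : realType) (b : bool) : numFieldType :=
  if b then (R[i] : numFieldType) else (R : numFieldType).

Definition cj (R : realType) (b : bool) : scal R b -> scal R b :=
  match b return scal R b -> scal R b with
  | true => @conjc R
  | false => id
  end.

Arguments scal : clear implicits.
Arguments cj : clear implicits.

Section Hilbert.
Variables (K : numFieldType) (conj : K -> K) (V : lmodType K) (ip : V -> V -> K).

Definition is_inner_product : Prop :=
  [/\ forall (a : K) (x y z : V), ip (a *: x + y) z = a * ip x z + ip y z,
      forall x y : V, ip y x = conj (ip x y),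
      forall x : V, 0 <= ip x x
    & forall x : V, ip x x = 0 -> x = 0].

(* ip x x is the squared norm; completeness w.r.t. the induced norm *)
Definition cauchy_seq (u : nat -> V) : Prop :=
  forall e : K, 0 < e -> exists N : nat, forall m k : nat, (N <= m)%N -> (N <= k)%N ->
    ip (u m - u k) (u m - u k) < e.

Definition converges_to (u : nat -> V) (l : V) : Prop :=
  forall e : K, 0 < e -> exists N : nat, forall m : nat, (N <= m)%N ->
    ip (u m - l) (u m - l) < e.

Definition is_complete : Prop :=
  forall u : nat -> V, cauchy_seq u -> exists l : V, converges_to u l.

Definition is_hilbert : Prop := is_inner_product /\ is_complete.

Definition lin_indep (n : nat) (v : 'I_n -> V) : Prop :=
  forall c : 'I_n -> K, \sum_(i < n) c i *: v i = 0 -> forall i, c i = 0.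

Definition subspace_has_dim (S : V -> Prop) (d : nat) : Prop :=
  exists v : 'I_d -> V, (forall i, S (v i)) /\ lin_indep v /\
    (forall y, S y -> exists c : 'I_d -> K, y = \sum_(i < d) c i *: v i).

Definition has_dim (d : nat) : Prop := subspace_has_dim (fun _ => True) d.

Definition dim_ge (n : nat) : Prop := exists v : 'I_n -> V, lin_indep v.

Definition inf_dim : Prop := forall n : nat, dim_ge n.

Definition is_linear (T : V -> V) : Prop :=
  forall (a : K) (x y : V), T (a *: x + y) = a *: T x + T y.

Definition is_conj_linear (T : V -> V) : Prop :=
  forall (a : K) (x y : V), T (a *: x + y) = conj a *: T x + T y.

Definition is_bounded (T : V -> V) : Prop :=
  exists M : K, forall x, ip (T x) (T x) <= M * ip x x.

Definition is_isometry (T : V -> V) : Prop := forall x, ip (T x) (T x) = ip x x.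

Definition is_adjoint (T T' : V -> V) : Prop := forall x y, ip (T x) y = ip x (T' y).

Definition is_conj_adjoint (T T' : V -> V) : Prop :=
  forall x y, ip (T x) y = conj (ip x (T' y)).

Definition is_projection (P : V -> V) : Prop :=
  [/\ is_linear P, is_bounded P, forall x, P (P x) = P x & is_adjoint P P].

Definition range (T : V -> V) (y : V) : Prop := exists x, y = T x.

Definition proj_rank (n : nat) (P : V -> V) : Prop :=
  is_projection P /\ subspace_has_dim (range P) n.

Definition proj_inf_rank (P : V -> V) : Prop :=
  is_projection P /\
  forall m : nat, exists v : 'I_m -> V, (forall i, range P (v i)) /\ lin_indep v.

Definition h_unitary (W : V -> V) : Prop :=
  [/\ is_linear W, is_isometry W & forall y, exists x, y = W x].

Definition h_antiunitary (W : V -> V) : Prop :=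
  [/\ is_conj_linear W, is_isometry W & forall y, exists x, y = W x].

(* A and B are unitarily (orthogonally) equivalent: B = W A W^* for a unitary W *)
Definition unit_equiv (A B : V -> V) : Prop :=
  exists W : V -> V, h_unitary W /\ forall x, W (A x) = B (W x).

Definition angle_eq (P Q P' Q' : V -> V) : Prop :=
  unit_equiv (Q \o P \o Q) (Q' \o P' \o Q').

End Hilbert.

(* Main.v *)
(** Finite rank.  Unitary equivalence of [QPQ] and [Q'P'Q'] gives equality of
    traces and preserves commutation.  Given a unit vector [x], complete it to an
    orthonormal system [X_0 = x, ..., X_n]; the images of the [n + 1] coordinate
    projections of rank [n] commute, so in a joint eigenbasis they become
    [n]-subsets of a finite set that pairwise meet in [n - 1] points.  Such a
    family either lies in one [(n + 1)]-subset, and then the combination of the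
    coordinate projections that equals the projection onto [x] is mapped to a
    projection onto a line [chi x], or it is a star around a common
    [(n - 1)]-subset; the latter needs [dim H >= 2n], and is impossible when
    [dim H > 2n] by comparison with a second system that meets the first one only
    in [x].  By preservation of the trace, [chi] preserves the angles between lines
    and is compatible with [phi], so Wigner's theorem (in its non-surjective form,
    proved following Bargmann) provides the isometry.

    Infinite rank.  On projections of infinite rank and corank, [phi] preserves
    orthogonality in both directions, hence order and the covering relation
    [M < M + x], which yields a map on lines.  The spectrum of [QPQ] shows that it
    preserves angles, and Wigner's theorem applies again.  Projections of finite
    corank are determined by the projections commuting with them. *)

Require Import Defs.
From mathcomp Require Import all_boot all_order all_algebra.
From mathcomp Require Import boolp reals complex.
From mathcomp Require Import ring zify.
Set Implicit Arguments. Unset Strict Implicit. Unset Printing Implicit Defensive.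
Import Order.TTheory GRing.Theory Num.Theory.
Local Open Scope ring_scope.

(** * Scalar fields with conjugation *)

Record conj_field (K : numFieldType) (conj : K -> K) : Prop := ConjField {
  conjD : {morph conj : a b / a + b};
  conjM : {morph conj : a b / a * b};
  conjK : involutive conj;
  mul_conj : forall a, a * conj a = `|a| ^+ 2;
  conj_nneg : forall a : K, 0 <= a -> conj a = a;
  exists_sqrt : forall a : K, 0 <= a -> exists2 r, 0 <= r & r ^+ 2 = a;
  exists_invS_lt : forall e : K, 0 < e -> exists N : nat, N.+1%:R^-1 < e;
  exists_inf : forall A : K -> Prop, (exists a, A a) -> (forall a, A a -> 0 <= a) ->
    exists m : K, [/\ 0 <= m, forall a, A a -> m <= a &
                  forall e : K, 0 < e -> exists2 a, A a & a < m + e];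
  real_or_complex : (forall a, conj a = a) \/
    exists j, [/\ j * j = -1, conj j = - j &
      forall a, exists p q, [/\ conj p = p, conj q = q & a = p + q * j]] }.

Lemma real_exists_invS_lt (R : realType) (e : R) :
  0 < e -> exists N : nat, N.+1%:R^-1 < e.
Proof. by move=> /ltr_add_invr[N]; rewrite add0r; exists N. Qed.

Lemma real_exists_inf (R : realType) (A : R -> Prop) :
  (exists a, A a) -> (forall a, A a -> 0 <= a) ->
  exists m, [/\ 0 <= m, forall a, A a -> m <= a &
                forall e, 0 < e -> exists2 a, A a & a < m + e].
Proof.
move=> [a0 Aa0] A_ge0.
have A_inf : classical_sets.has_inf (A : classical_sets.set R).
  by split; [exists a0 | exists 0 => a /A_ge0].
exists (inf (A : classical_sets.set R)); split.
- by apply: lb_le_inf; [exists a0 | move=> a /A_ge0].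
- by move=> a Aa; apply: ge_inf => //; case: A_inf.
- by move=> e e_gt0; have [a Aa lt_a] := inf_adherent e_gt0 A_inf; exists a.
Qed.

Lemma complex_exists_inf (R : realType) (A : R[i] -> Prop) :
  (exists a, A a) -> (forall a, A a -> 0 <= a) ->
  exists m, [/\ 0 <= m, forall a, A a -> m <= a &
                forall e, 0 < e -> exists2 a, A a & a < m + e].
Proof.
move=> [a0 Aa0] A_ge0.
have A_real a : A a -> a = (complex.Re a)%:C%C.
  by move/A_ge0/ger0_Im; case: a => x y /= ->.
have [||m [m_ge0 m_lb m_approx]] := @real_exists_inf R (fun x => A x%:C%C).
- by exists (complex.Re a0); rewrite -A_real.
- by move=> x /A_ge0; rewrite ler0c.
exists m%:C%C; split; first by rewrite ler0c.
- by move=> a Aa; rewrite (A_real _ Aa) lecR; apply: m_lb; rewrite -A_real.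
- move=> [e f]; rewrite ltcE => /andP[/eqP /= -> /m_approx[a Aa lt_a]].
  by exists a%:C%C => //; rewrite complexr0 -rmorphD ltcR.
Qed.

Lemma conj_field_real (R : realType) : @conj_field R id.
Proof.
split=> //=.
- by move=> a; rewrite -normrX ger0_norm ?sqr_ge0 // expr2.
- by move=> a a_ge0; exists (Num.sqrt a); rewrite ?sqrtr_ge0 ?sqr_sqrtr.
- exact: real_exists_invS_lt.
- exact: real_exists_inf.
- by left.
Qed.

Lemma conj_field_complex (R : realType) : @conj_field R[i] (@conjc R).
Proof.
split.
- exact: rmorphD.
- exact: rmorphM.
- exact: conjcK.
- by move=> a; rewrite sqr_normc.
- by move=> [a c]; rewrite lecE => /andP[/eqP /= ->]; rewrite oppr0.
- move=> [a c]; rewrite lecE => /andP[/eqP /= -> a_ge0].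
  exists (Num.sqrt a)%:C%C; first by rewrite ler0c sqrtr_ge0.
  by rewrite -rmorphXn sqr_sqrtr.
- move=> [a c]; rewrite ltcE => /andP[/eqP /= -> /real_exists_invS_lt[N ltN]].
  by exists N; rewrite complexr0 -(rmorph_nat (real_complex R)) -fmorphV ltcR.
- exact: complex_exists_inf.
- right; exists 'i%C; split.
  + by rewrite -expr2 sqr_i.
  + by apply/eqP; rewrite eq_complex /= oppr0 !eqxx.
  + move=> a; exists (complex.Re a)%:C%C, (complex.Im a)%:C%C.
    by split; rewrite /= ?oppr0 // mulrC -complexE.
Qed.

Lemma conj_field_scal (R : realType) (b : bool) : conj_field (cj R b).
Proof. by case: b; [exact: conj_field_complex | exact: conj_field_real]. Qed.

(** * Families of [n]-sets pairwise meeting in [n - 1] points *)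

Section SetFamily.
Variables (n : nat) (I T : finType) (F : I -> {set T}) (o : I).
Hypothesis card_I : #|I| = n.+1.
Hypothesis n_gt0 : (0 < n)%N.
Hypothesis card_F : forall i, #|F i| = n.
Hypothesis card_FI : forall i j, i != j -> #|F i :&: F j| = n.-1.

Definition degree (l : T) := #|[set i | l \in F i]|.

Lemma family_inj : injective F.
Proof.
move=> i j Fij; apply/eqP/negPn/negP => /card_FI; rewrite Fij setIid card_F.
by move: n_gt0; lia.
Qed.

Lemma card_familyD i j : i != j -> #|F i :\: F j| = 1%N.
Proof. by move=> ij; rewrite cardsD card_F card_FI //; move: n_gt0; lia. Qed.

Lemma sum_degree_off : (\sum_(l in ~: F o) degree l = n)%N.
Proof.
under eq_bigr => l _ do rewrite /degree -sum1dep_card.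
rewrite (exchange_big_dep predT) //= (bigD1 o) //= big_pred0 => [|l]; last first.
  by rewrite inE andNb.
rewrite (eq_bigr (fun=> 1%N)) => [|i io]; first by rewrite sum1_card cardC1 card_I.
by rewrite -[RHS](card_familyD io) sum1dep_card; apply: eq_card => l; rewrite !inE.
Qed.

Definition is_star := forall l, l \notin F o -> (degree l <= 1)%N.

Lemma star_family_card : is_star -> (n + n <= #|T|)%N.
Proof.
move=> degree_le1; rewrite -(cardsC (F o)) card_F leq_add2l.
rewrite -[leqLHS]sum_degree_off -sum1_card; apply: leq_sum => l.
by rewrite inE; exact: degree_le1.
Qed.

Lemma off_base_inj i x y :
  x \in F i :\: F o -> y \in F i :\: F o -> x = y.
Proof.
have [->|io] := eqVneq i o; first by rewrite setDv inE.
have /eqP/cards1P[z ->] := card_familyD io.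
by move=> /set1P-> /set1P->.
Qed.

Lemma family_memE i k : k \in F i :\: F o -> F i = k |: (F i :&: F o).
Proof.
move=> ik; have [ik_in _] := setDP ik; apply/setP => x; rewrite !inE.
have [->|xk] := eqVneq x k; first by rewrite ik_in.
case: (boolP (x \in F i)) => //= xi; apply/esym/negPn/negP => xo.
by move/eqP: xk; apply; apply: off_base_inj ik; rewrite inE xo.
Qed.

(* The point [k] is the only one of [F i] off [F o], so that [F i] and [F l]
   meet inside [F o], and by cardinality all the pairwise meets agree. *)
Lemma family_base_meet i l k : l != o -> k \in F i :\: F o -> k \notin F l ->
  F i :&: F o = F l :&: F o.
Proof.
move=> lo ik lk; have [ik_in ko] := setDP ik.
have il : i != l by apply: contraNneq lk => <-.
have io : i != o by apply: contraNneq ko => <-.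
have meet_sub : F i :&: F l \subset F o.
  apply/subsetP => x /setIP[xi xl]; apply/negPn/negP => xo.
  by case/negP: lk; rewrite (off_base_inj ik (y := x)) // inE xo.
have -> : F i :&: F o = F i :&: F l.
  by apply/esym/eqP; rewrite eqEcard !card_FI // leqnn subsetI subsetIl meet_sub.
by apply/eqP; rewrite eqEcard !card_FI // leqnn subsetI subsetIr meet_sub.
Qed.

Lemma family_sub_setU1 k : k \notin F o -> (1 < degree k)%N ->
  forall l, F l \subset k |: F o.
Proof.
move=> ko /card_gt1P[i [j []]]; rewrite !inE => ki kj ij l.
have [ik jk] : k \in F i :\: F o /\ k \in F j :\: F o by rewrite !inE ko.
have [->|lo] := eqVneq l o; first exact: subsetUr.
have [kl|kl] := boolP (k \in F l).
  by rewrite (@family_memE l k) ?inE ?ko ?kl // setUS // subsetIr.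
case/eqP: ij; apply: family_inj; rewrite (family_memE ik) (family_memE jk).
by rewrite (family_base_meet lo ik kl) (family_base_meet lo jk kl).
Qed.

Lemma degree_codim1 (G : {set T}) : #|G| = n.+1 -> (forall i, F i \subset G) ->
  forall l, degree l = (n * (l \in G))%N.
Proof.
move=> card_G sub l.
have /fin_all_exists[g gE] i : exists g, G :\: F i = [set g].
  by apply/cards1P; rewrite cardsD card_G (setIidPr (sub i)) card_F subSnn.
have FE i : F i = G :\ g i.
  by rewrite -gE setDDr setDv set0U; apply/esym/setIidPr.
have g_inj : injective g by move=> i j gij; apply: family_inj; rewrite !FE gij.
have g_onto : g @: setT = G.
  apply/eqP; rewrite eqEcard card_G card_imset // cardsT card_I leqnn andbT.
  apply/subsetP => x /imsetP[i _ ->].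
  by have : g i \in G :\: F i by [rewrite gE set11]; case/setDP.
have [|lG] := boolP (l \in G); last first.
  rewrite muln0; apply: eq_card0 => i; rewrite inE.
  by apply/negbTE; apply: contraNN lG => /(subsetP (sub i)).
rewrite muln1 -g_onto => /imsetP[i _ ->].
have -> : n = #|[set~ i]| by rewrite cardsC1 card_I.
apply: eq_card => j; rewrite !inE FE !inE (inj_eq g_inj) eq_sym.
by rewrite -g_onto imset_f // andbT.
Qed.

Lemma family_dichotomy :
  (exists k, forall l, degree l = (n * ((l \in F o) + (l == k)))%N) \/ is_star.
Proof.
have [/existsP[k /andP[ko deg_k]]|/existsPn star] :=
    boolP [exists k, (k \notin F o) && (1 < degree k)%N]; last first.
  by right=> l lo; move: (star l); rewrite lo /= -leqNgt.
left; exists k => l; rewrite (degree_codim1 _ (family_sub_setU1 ko deg_k)); last first.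
  by rewrite cardsU1 ko card_F.
by rewrite !inE; have [->|_] := eqVneq l k; rewrite ?(negPf ko) ?addn0.
Qed.

End SetFamily.

(** * Weighted sums over families of sets *)

Section WeightedSums.
Variable R : pzSemiRingType.

Definition weight (I L : finType) (a : I -> R) (F : I -> {set L}) (l : L) : R :=
  \sum_(i | l \in F i) a i.

Lemma sum_weight (I L : finType) (a : I -> R) (F : I -> {set L}) (g : L -> R) :
  \sum_i a i * (\sum_(l in F i) g l) = \sum_l weight a F l * g l.
Proof.
under eq_bigr => i _ do rewrite mulr_sumr.
rewrite (exchange_big_dep predT) //=; apply: eq_bigr => l _.
by rewrite -mulr_suml.
Qed.

Lemma sum_scaled_indicator (I : finType) (k : I) (a : R) (g : I -> R) :
  \sum_l a * (l == k)%:R * g l = a * g k.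
Proof.
rewrite (bigD1 k) //= eqxx mulr1 big1 ?addr0 // => l /negPf->.
by rewrite mulr0 mul0r.
Qed.

End WeightedSums.

(** * Linear independence *)

Lemma exists_left_kernel (F : fieldType) m d (M : 'M[F]_(m, d)) : (d < m)%N ->
  exists2 c : 'rV[F]_m, c != 0 & c *m M = 0.
Proof.
move=> dm; have : kermx M != 0.
  rewrite -mxrank_eq0 mxrank_ker subn_eq0 -ltnNge.
  exact: leq_ltn_trans (rank_leq_col _) dm.
by case/rowV0Pn => c /sub_kermxP cM c_neq0; exists c.
Qed.

Lemma lin_indep_leq (K : numFieldType) (V : lmodType K) m d
    (v : 'I_m -> V) (w : 'I_d -> V) : lin_indep v ->
  (forall i, exists c : 'I_d -> K, v i = \sum_(j < d) c j *: w j) -> (m <= d)%N.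
Proof.
move=> iv /choice[C vC]; rewrite leqNgt; apply/negP => dm.
have [c /eqP + cC] := exists_left_kernel (\matrix_(i, j) C i j) dm.
case; apply/rowP => i; rewrite mxE; apply: (iv (fun i => c 0 i)).
under eq_bigr => k _ do rewrite vC scaler_sumr.
rewrite exchange_big /= big1 // => j _.
under eq_bigr => k _ do rewrite scalerA.
rewrite -scaler_suml; have /rowP/(_ j) := cC; rewrite !mxE.
by under eq_bigr => k _ do rewrite mxE; move=> ->; rewrite scale0r.
Qed.

Section HilbertSpace.
Variables (K : numFieldType) (conj : K -> K) (H : lmodType K) (ip : H -> H -> K).
Hypothesis cK : conj_field conj.
Hypothesis ipP : is_inner_product conj ip.

(** * Inner product spaces *)

Lemma conj0 : conj 0 = 0.
Proof. exact: conj_nneg. Qed.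

Lemma conj1 : conj 1 = 1.
Proof. exact: conj_nneg. Qed.

Lemma conjN a : conj (- a) = - conj a.
Proof. by apply/eqP; rewrite -addr_eq0 -(conjD cK) addNr conj0. Qed.

Lemma norm_conj a : `|conj a| = `|a|.
Proof.
apply/eqP; rewrite -(eqrXn2 (n := 2)) //.
by rewrite -!(mul_conj cK) (conjK cK) mulrC.
Qed.

Lemma ipC x y : ip y x = conj (ip x y).
Proof. by case: ipP. Qed.

Lemma ip_ge0 x : 0 <= ip x x.
Proof. by case: ipP. Qed.

Lemma ipDl x y z : ip (x + y) z = ip x z + ip y z.
Proof. by case: ipP => lin _ _ _; have := lin 1 x y z; rewrite scale1r mul1r. Qed.

Lemma ip0l z : ip 0 z = 0.
Proof. by apply: (addrI (ip 0 z)); rewrite -ipDl !addr0. Qed.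

Lemma ip_eq0 x : (ip x x == 0) = (x == 0).
Proof.
by case: ipP => _ _ _ def; apply/eqP/eqP => [/def // | ->]; exact: ip0l.
Qed.

Lemma ip_gt0 x : (0 < ip x x) = (x != 0).
Proof. by rewrite lt_def ip_ge0 andbT ip_eq0. Qed.

Lemma ipZl a x z : ip (a *: x) z = a * ip x z.
Proof. by case: ipP => lin _ _ _; have := lin a x 0 z; rewrite ip0l !addr0. Qed.

Lemma ipNl x z : ip (- x) z = - ip x z.
Proof. by rewrite -scaleN1r ipZl mulN1r. Qed.

Lemma ipBl x y z : ip (x - y) z = ip x z - ip y z.
Proof. by rewrite ipDl ipNl. Qed.

Lemma ip_suml (I : finType) (A : {pred I}) (F : I -> H) z :
  ip (\sum_(i in A) F i) z = \sum_(i in A) ip (F i) z.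
Proof. by rewrite (big_morph (ip^~ z) (fun x y => ipDl x y z) (ip0l z)). Qed.

Lemma ip0r z : ip z 0 = 0.
Proof. by rewrite ipC ip0l conj0. Qed.

Lemma ipDr x y z : ip z (x + y) = ip z x + ip z y.
Proof. by rewrite ipC ipDl (conjD cK) -!ipC. Qed.

Lemma ipZr a x z : ip z (a *: x) = conj a * ip z x.
Proof. by rewrite ipC ipZl (conjM cK) -ipC. Qed.

Lemma ipNr x z : ip z (- x) = - ip z x.
Proof. by rewrite ipC ipNl conjN -ipC. Qed.

Lemma ipBr x y z : ip z (x - y) = ip z x - ip z y.
Proof. by rewrite ipDr ipNr. Qed.

Lemma ip_sumr (I : finType) (A : {pred I}) (F : I -> H) z :
  ip z (\sum_(i in A) F i) = \sum_(i in A) ip z (F i).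
Proof. by rewrite (big_morph (ip z) (fun x y => ipDr x y z) (ip0r z)). Qed.

Lemma ip_sym0 x y : ip x y = 0 -> ip y x = 0.
Proof. by move=> xy; rewrite ipC xy conj0. Qed.

Lemma sqr_norm_ip x y : `|ip x y| ^+ 2 = ip x y * ip y x.
Proof. by rewrite -(mul_conj cK) -ipC. Qed.

Lemma norm_ipC x y : `|ip x y| = `|ip y x|.
Proof. by rewrite ipC norm_conj. Qed.

Lemma ip_injl x y : (forall z, ip x z = ip y z) -> x = y.
Proof. by move=> xy; apply/eqP; rewrite -subr_eq0 -ip_eq0 ipBl xy subrr. Qed.

Definition unit_vector (u : H) := ip u u = 1.

Lemma unit_vector_neq0 u : unit_vector u -> u != 0.
Proof. by rewrite /unit_vector -ip_eq0 => ->; exact: oner_neq0. Qed.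

Lemma ip_unitD u x y : unit_vector u -> ip x u = 0 -> ip y u = 0 ->
  ip (u + x) (u + y) = 1 + ip x y.
Proof.
by move=> u_unit xu yu; rewrite !(ipDl, ipDr) u_unit xu (ip_sym0 yu) addr0 add0r.
Qed.

Lemma ip_sqr_unit_comb a u x : unit_vector u -> ip x u = 0 ->
  ip (a *: u + x) (a *: u + x) = `|a| ^+ 2 + ip x x.
Proof.
move=> u_unit xu; rewrite !(ipDl, ipDr, ipZl, ipZr) u_unit xu (ip_sym0 xu) -(mul_conj cK).
by ring.
Qed.

Lemma exists_unit x : x != 0 -> exists2 a, 0 < a & unit_vector (a *: x).
Proof.
move=> x_neq0; have [r r_ge0 rr] := exists_sqrt cK (ip_ge0 x).
have r_gt0 : 0 < r by rewrite lt_def r_ge0 andbT -sqrf_eq0 rr ip_eq0.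
exists r^-1; first by rewrite invr_gt0.
rewrite /unit_vector ipZl ipZr (conj_nneg cK) ?invr_ge0 // mulrA -rr; field.
by rewrite gt_eqF.
Qed.

Lemma ip_unit_resid x u : unit_vector u ->
  ip (x - ip x u *: u) (x - ip x u *: u) = ip x x - `|ip x u| ^+ 2.
Proof.
by move=> u_unit; rewrite !(ipBl, ipBr, ipZl, ipZr) u_unit -ipC sqr_norm_ip mulr1; ring.
Qed.

Lemma cauchy_schwarz_unit x u : unit_vector u -> `|ip x u| ^+ 2 <= ip x x.
Proof. by move=> u_unit; rewrite -subr_ge0 -ip_unit_resid // ip_ge0. Qed.

Lemma cauchy_schwarz x y : `|ip x y| ^+ 2 <= ip x x * ip y y.
Proof.
have [->|y_neq0] := eqVneq y 0; first by rewrite !ip0r normr0 expr0n mulr0.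
have [a a_gt0 ay_unit] := exists_unit y_neq0.
have := cauchy_schwarz_unit x ay_unit; move: ay_unit.
rewrite /unit_vector ipZl !ipZr (conj_nneg cK (ltW a_gt0)) normrM exprMn.
rewrite (gtr0_norm a_gt0) mulrA -expr2 => ay_unit.
by rewrite -(ler_pM2r (x := ip y y)) ?ip_gt0 // mulrAC ay_unit mul1r.
Qed.

Lemma cauchy_schwarz_eq u v : v != 0 -> `|ip u v| ^+ 2 = ip u u * ip v v ->
  u = (ip u v / ip v v) *: v.
Proof.
rewrite -ip_eq0 => vv_neq0; rewrite sqr_norm_ip => uv_eq.
apply/eqP; rewrite -subr_eq0 -ip_eq0 !(ipBl, ipBr, ipZl, ipZr) (conjM cK) -ipC.
rewrite (conj_nneg cK (a := (ip v v)^-1)) ?invr_ge0 ?ip_ge0 //; apply/eqP.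
transitivity (ip u u - ip u v * ip v u / ip v v); first by field.
by rewrite uv_eq mulfK ?subrr.
Qed.

Lemma cauchy_schwarz_unit_eq x u : unit_vector u -> `|ip x u| ^+ 2 = ip x x ->
  x = ip x u *: u.
Proof.
move=> u_unit xu; have := cauchy_schwarz_eq (unit_vector_neq0 u_unit) (u := x).
by rewrite u_unit mulr1 divr1 => /(_ xu).
Qed.

Lemma parallelogram x y z : ip (x - y) (x - y) =
  2 * ip (z - x) (z - x) + 2 * ip (z - y) (z - y) -
  4 * ip (z - 2^-1 *: (x + y)) (z - 2^-1 *: (x + y)).
Proof.
have conj_half : conj 2^-1 = 2^-1 by rewrite (conj_nneg cK) // invr_ge0.
by rewrite !(ipBl, ipBr, ipZl, ipZr, ipDl, ipDr) conj_half; field.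
Qed.

(** * Semilinear maps and isometries *)

Definition scalar_aut (s : K -> K) := s = id \/ s = conj.

Section ScalarAut.
Variable s : K -> K.
Hypothesis s_aut : scalar_aut s.

Lemma scalar_autD : {morph s : a b / a + b}.
Proof. by case: s_aut => -> // a b; rewrite (conjD cK). Qed.

Lemma scalar_autM : {morph s : a b / a * b}.
Proof. by case: s_aut => -> // a b; rewrite (conjM cK). Qed.

Lemma scalar_aut0 : s 0 = 0.
Proof. by case: s_aut => ->; rewrite ?conj0. Qed.

Lemma scalar_aut1 : s 1 = 1.
Proof. by case: s_aut => ->; rewrite ?conj1. Qed.

Lemma scalar_autK : involutive s.
Proof. by case: s_aut => -> //; exact: conjK. Qed.

Lemma scalar_aut_conj a : s (conj a) = conj (s a).
Proof. by case: s_aut => ->. Qed.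

Lemma scalar_aut_real a : conj a = a -> s a = a.
Proof. by case: s_aut => ->. Qed.

Lemma norm_scalar_aut a : `|s a| = `|a|.
Proof. by case: s_aut => -> //; rewrite norm_conj. Qed.

End ScalarAut.

Record semilinear (s : K -> K) (V : H -> H) : Prop := Semilinear {
  semilinear_aut : scalar_aut s;
  semilinearP : forall a x y, V (a *: x + y) = s a *: V x + V y }.

Lemma is_linear_semilinear T : is_linear T -> semilinear id T.
Proof. by split=> //; left. Qed.

Section SemilinearTheory.
Variables (s : K -> K) (V : H -> H).
Hypothesis linV : semilinear s V.

Let s_aut : scalar_aut s := semilinear_aut linV.

Lemma semilinearD : {morph V : x y / x + y}.
Proof.
by move=> x y; have := semilinearP linV 1 x y; rewrite scalar_aut1 // !scale1r.
Qed.

Lemma semilinear0 : V 0 = 0.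
Proof. by apply: (addrI (V 0)); rewrite -semilinearD !addr0. Qed.

Lemma semilinearB : {morph V : x y / x - y}.
Proof. by move=> x y; apply: (addIr (V y)); rewrite -semilinearD !subrK. Qed.

Lemma semilinearZ a x : V (a *: x) = s a *: V x.
Proof. by have := semilinearP linV a x 0; rewrite semilinear0 !addr0. Qed.

Lemma semilinear_sum (I : finType) (A : {pred I}) (F : I -> H) :
  V (\sum_(i in A) F i) = \sum_(i in A) V (F i).
Proof. by rewrite (big_morph V semilinearD semilinear0). Qed.

End SemilinearTheory.

Lemma isometry_ip_re V : {morph V : x y / x + y} -> is_isometry ip V ->
  forall x y, ip (V x) (V y) + ip (V y) (V x) = ip x y + ip y x.
Proof.
move=> addV isoV x y; have := isoV (x + y).
rewrite addV !(ipDl, ipDr) !isoV => norm_eq.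
by apply: (addrI (ip x x)); apply: (addIr (ip y y)); rewrite !addrA in norm_eq *.
Qed.

Lemma conj_pairing_eq0 d : (forall a, conj a * d + a * conj d = 0) -> d = 0.
Proof.
move=> /(_ d); rewrite mulrC -mulr2n => /eqP; rewrite mulrn_eq0 /= (mul_conj cK).
by rewrite sqrf_eq0 normr_eq0 => /eqP.
Qed.

Record semilinear_isometry (s : K -> K) (V : H -> H) : Prop := SemilinearIsometry {
  isometry_semilinear : semilinear s V;
  isometry_norm : is_isometry ip V }.

Section SemilinearIsometryTheory.
Variables (s : K -> K) (V : H -> H).
Hypothesis isoV : semilinear_isometry s V.

Let linV : semilinear s V := isometry_semilinear isoV.
Let s_aut : scalar_aut s := semilinear_aut linV.

Lemma semilinear_isometry_ip x y : ip (V x) (V y) = s (ip x y).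
Proof.
apply/eqP; rewrite -subr_eq0; apply/eqP/conj_pairing_eq0 => a.
have := isometry_ip_re (semilinearD linV) (isometry_norm isoV) x (s a *: y).
rewrite (semilinearZ linV) scalar_autK // !(ipZl, ipZr).
rewrite -[RHS](scalar_aut_real s_aut); last first.
  by rewrite (conjD cK) !(conjM cK) (conjK cK) -!ipC addrC.
rewrite (scalar_autD s_aut) !(scalar_autM s_aut) (scalar_aut_conj s_aut).
rewrite (scalar_autK s_aut) (ipC x y) (ipC (V x) (V y)) (scalar_aut_conj s_aut) => /eqP.
rewrite -subr_eq0 (conjD cK) conjN => /eqP re_eq0; rewrite -[RHS]re_eq0; ring.
Qed.

Lemma semilinear_isometry_inj : injective V.
Proof.
move=> x y Vxy; apply/eqP; rewrite -subr_eq0 -ip_eq0 -(isometry_norm isoV).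
by rewrite (semilinearB linV) Vxy subrr ip0l.
Qed.

End SemilinearIsometryTheory.

Lemma unitary_isometry W : h_unitary ip W -> semilinear_isometry id W.
Proof. by case=> linW isoW _; split=> //; exact: is_linear_semilinear. Qed.

Lemma unitary_linear W : h_unitary ip W -> semilinear id W.
Proof. by move=> uW; exact: isometry_semilinear (unitary_isometry uW). Qed.

Lemma unitary_ip W : h_unitary ip W -> forall x y, ip (W x) (W y) = ip x y.
Proof. by move=> /unitary_isometry; exact: semilinear_isometry_ip. Qed.

Lemma unitary_inv W : h_unitary ip W ->
  exists2 W', h_unitary ip W' & cancel W W'.
Proof.
move=> uW; have [linW isoW surjW] := uW.
have injW := semilinear_isometry_inj (unitary_isometry uW).
have [W' WW'] := choice surjW.
have W'W : cancel W W' by move=> x; apply: injW; rewrite -WW'.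
exists W' => //; split.
- by move=> a x y; apply: injW; rewrite linW -!WW'.
- by move=> x; rewrite {3 4}(WW' x) isoW.
- by move=> y; exists (W y).
Qed.

(** * Projections *)

Lemma projection_idem P : is_projection ip P -> forall x, P (P x) = P x.
Proof. by case. Qed.

Lemma projection_adj P : is_projection ip P -> is_adjoint ip P P.
Proof. by case. Qed.

Lemma projection_linear P : is_projection ip P -> semilinear id P.
Proof. by case=> /is_linear_semilinear. Qed.

Lemma projection_of_idempotent P : is_linear P -> (forall x, P (P x) = P x) ->
  is_adjoint ip P P -> is_projection ip P.
Proof.
move=> linP idemP adjP; split=> //; exists 1 => x; rewrite mul1r.
have -> : ip x x = ip (P x) (P x) + ip (x - P x) (x - P x).
  by rewrite !(ipBl, ipBr) -(adjP (P x) x) idemP -(adjP x x); ring.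
by rewrite lerDl ip_ge0.
Qed.

Lemma projection_id : is_projection ip id.
Proof. exact: projection_of_idempotent. Qed.

Section ProjectionTheory.
Variable P : H -> H.
Hypothesis projP : is_projection ip P.

Let linP : semilinear id P := projection_linear projP.

Lemma projectionD : {morph P : x y / x + y}. Proof. exact: semilinearD linP. Qed.

Lemma projection0 : P 0 = 0. Proof. exact: semilinear0 linP. Qed.

Lemma projectionB : {morph P : x y / x - y}. Proof. exact: semilinearB linP. Qed.

Lemma projectionZ a x : P (a *: x) = a *: P x. Proof. exact: (semilinearZ linP a x). Qed.

Lemma projection_sum (I : finType) (A : {pred I}) (F : I -> H) :
  P (\sum_(i in A) F i) = \sum_(i in A) P (F i).
Proof. exact: (semilinear_sum linP). Qed.

Lemma projection_ip x y : ip (P x) (P y) = ip (P x) y.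
Proof. by rewrite -(projection_adj projP) (projection_idem projP). Qed.

Lemma projection_pythagoras x :
  ip x x = ip (P x) (P x) + ip (x - P x) (x - P x).
Proof.
by rewrite !(ipBl, ipBr) projection_ip -(projection_adj projP x x); ring.
Qed.

Lemma projection_le x : ip (P x) (P x) <= ip x x.
Proof. by rewrite (projection_pythagoras x) lerDl ip_ge0. Qed.

Lemma projection_fixed x : ip (P x) x = ip x x -> P x = x.
Proof.
move=> Px; apply/esym/eqP; rewrite -subr_eq0 -ip_eq0.
have /eqP := projection_pythagoras x.
by rewrite projection_ip Px -[X in X == _]addr0 (inj_eq (addrI _)) eq_sym.
Qed.

Lemma range_projection y : range P y <-> P y = y.
Proof.
split=> [[x ->]|<-]; first exact: projection_idem.
by exists y.
Qed.

Lemma projection_orth x y : P x = x -> P y = 0 -> ip x y = 0.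
Proof. by move=> <- Py; rewrite (projection_adj projP) Py ip0r. Qed.

End ProjectionTheory.

Lemma self_adjoint_comp A B C :
  is_adjoint ip A A -> is_adjoint ip B B -> is_adjoint ip C C ->
  (forall x, A (B x) = C x) -> forall x, B (A x) = C x.
Proof.
by move=> adjA adjB adjC AB x; apply: ip_injl => z; rewrite adjB adjA AB adjC.
Qed.

Lemma projection_eq P Q : is_projection ip P -> is_projection ip Q ->
  (forall x, P (Q x) = Q x) -> (forall x, Q (P x) = P x) -> P = Q.
Proof.
move=> projP projQ PQ QP; apply/funext => x.
have [adjP adjQ] := (projection_adj projP, projection_adj projQ).
by rewrite -QP; exact: (self_adjoint_comp adjP adjQ adjQ PQ).
Qed.

Lemma idempotent_eigenvector T c x : semilinear id T ->
  (forall y, T (T y) = T y) -> T x = c *: x -> T x = 0 \/ T x = x.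
Proof.
move=> linT idemT Tx; have := idemT x; rewrite {1}Tx (semilinearZ linT).
have [|Tx_neq0] := eqVneq (T x) 0; first by left.
move/eqP; rewrite -subr_eq0 -[X in _ - X]scale1r -scalerBl scaler_eq0 (negPf Tx_neq0).
by rewrite orbF subr_eq0 => /eqP c1; right; rewrite Tx c1 scale1r.
Qed.

(** * Orthonormal families *)

Definition orthonormal (I : eqType) (e : I -> H) :=
  forall i j, ip (e i) (e j) = (i == j)%:R.

Definition orth_to (u : H) (l : seq H) := forall y, y \in l -> ip u y = 0.

Definition has_unit_orth (S : H -> Prop) (l : seq H) :=
  exists u, [/\ S u, unit_vector u & orth_to u l].

Definition fcons n (u : H) (f : 'I_n -> H) (i : 'I_n.+1) : H :=
  oapp f u (unlift ord0 i).

Lemma fcons0 n u (f : 'I_n -> H) : fcons u f ord0 = u.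
Proof. by rewrite /fcons unlift_none. Qed.

Lemma fconsS n u (f : 'I_n -> H) i : fcons u f (lift ord0 i) = f i.
Proof. by rewrite /fcons liftK. Qed.

Lemma fconsP n (S : H -> Prop) u (f : 'I_n -> H) :
  S u -> (forall i, S (f i)) -> forall i, S (fcons u f i).
Proof.
by move=> Su Sf i; case: (unliftP ord0 i) => [j|] ->; rewrite ?fconsS ?fcons0.
Qed.

Lemma orthonormal_unit (I : eqType) (e : I -> H) i : orthonormal e -> unit_vector (e i).
Proof. by move=> oe; rewrite /unit_vector oe eqxx. Qed.

Lemma orthonormal_comp (I J : eqType) (e : I -> H) (h : J -> I) :
  injective h -> orthonormal e -> orthonormal (e \o h).
Proof. by move=> h_inj oe i j; rewrite /= oe (inj_eq h_inj). Qed.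

Lemma orthonormal_isometry (I : eqType) (e : I -> H) s V :
  semilinear_isometry s V -> orthonormal e -> orthonormal (V \o e).
Proof.
move=> isoV oe i j; have s_aut := semilinear_aut (isometry_semilinear isoV).
rewrite /= (semilinear_isometry_ip isoV) oe.
by case: (i == j); [exact: scalar_aut1 | exact: scalar_aut0].
Qed.

Lemma orthonormal_fcons n u (f : 'I_n -> H) : unit_vector u -> orthonormal f ->
  (forall i, ip u (f i) = 0) -> orthonormal (fcons u f).
Proof.
move=> u_unit of_ uf i j.
case: (unliftP ord0 i) => [i'|] ->; case: (unliftP ord0 j) => [j'|] ->;
  rewrite ?fconsS ?fcons0 ?(inj_eq lift_inj) ?eqxx //.
by rewrite ip_sym0.
Qed.

Lemma orthonormal_lin_indep n (e : 'I_n -> H) : orthonormal e -> lin_indep e.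
Proof.
move=> oe c sum0 i; have := ip0l (e i); rewrite -sum0 ip_suml (bigD1 i) //=.
rewrite ipZl oe eqxx mulr1 big1 ?addr0 // => j ji.
by rewrite ipZl oe (negPf ji) mulr0.
Qed.

Lemma exists_orthonormal S D : (forall l, (size l < D)%N -> has_unit_orth S l) ->
  forall m l, (size l + m <= D)%N ->
  exists f : 'I_m -> H,
    [/\ orthonormal f, forall i, S (f i) & forall i, orth_to (f i) l].
Proof.
move=> exS; elim=> [|m IH] l lm; first by exists (fun _ => 0); split; case.
have [|u [Su u_unit ul]] := exS l; first by lia.
have [|f [of_ Sf fl]] := IH (u :: l); first by rewrite /=; lia.
exists (fcons u f); split; last 2 first.
- exact: fconsP.
- by apply: (fconsP (S := orth_to^~ l)) => // i y yl; apply: fl; rewrite inE yl orbT.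
apply: orthonormal_fcons => // i; apply: ip_sym0; apply: fl; exact: mem_head.
Qed.

Lemma exists_orthonormal_seq (S : nat -> H -> Prop) :
  (forall k l, has_unit_orth (S k) l) ->
  exists2 m : nat -> H, orthonormal m & forall k, S k (m k).
Proof.
move=> exS; have /choice[next nextP] (p : nat * seq H) :
    exists u, [/\ S p.1 u, unit_vector u & orth_to u p.2] by exact: exS.
pose fix prefix k := if k is k'.+1 then next (k', prefix k') :: prefix k' else [::].
pose m k := next (k, prefix k).
have mem_prefix i j : (i < j)%N -> m i \in prefix j.
  elim: j => // j IH; rewrite ltnS leq_eqVlt => /orP[/eqP->|/IH ij] /=.
    exact: mem_head.
  by rewrite inE ij orbT.
have m_orth i j : (i < j)%N -> ip (m j) (m i) = 0.
  by move=> ij; have [_ _] := nextP (j, prefix j); apply; exact: mem_prefix.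
exists m => [i j|k]; last by have [] := nextP (k, prefix k).
case: (ltngtP i j) => [ij|ji|->]; [exact/ip_sym0/m_orth | exact: m_orth |].
by have [_ ->] := nextP (j, prefix j).
Qed.

Lemma lin_indep_has_unit_orth P d (w : 'I_d -> H) l : is_projection ip P ->
  lin_indep w -> (forall i, P (w i) = w i) -> (size l < d)%N ->
  has_unit_orth (fun u => P u = u) l.
Proof.
move=> projP iw Pw ld.
have [c c_neq0 cM] :=
  exists_left_kernel (\matrix_(i < d, j < size l) ip (w i) (nth 0 l j)) ld.
pose z := \sum_(i < d) c 0 i *: w i.
have Pz : P z = z.
  rewrite (projection_sum projP); apply: eq_bigr => i _.
  by rewrite (projectionZ projP) Pw.
have zl : orth_to z l.
  move=> y yl; have yl_lt : (index y l < size l)%N by rewrite index_mem.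
  have /rowP/(_ (Ordinal yl_lt)) := cM; rewrite !mxE => cM_y.
  rewrite ip_suml -[RHS]cM_y; apply: eq_bigr => i _.
  by rewrite ipZl mxE nth_index.
have z_neq0 : z != 0.
  by apply: contraNneq c_neq0 => /iw c0; apply/eqP/rowP => i; rewrite c0 mxE.
have [a _ az_unit] := exists_unit z_neq0; exists (a *: z); split=> //.
  by rewrite (projectionZ projP) Pz.
by move=> y yl; rewrite ipZl zl ?mulr0.
Qed.

Lemma dim_ge_has_unit_orth m l :
  dim_ge H m -> (size l < m)%N -> has_unit_orth (fun _ => True) l.
Proof.
move=> [w iw] lm.
have [u [_ u_unit ul]] := lin_indep_has_unit_orth projection_id iw (fun=> erefl) lm.
by exists u.
Qed.

Lemma orthonormal_dim_ge m d (e : 'I_d -> H) : orthonormal e -> (m <= d)%N -> dim_ge H m.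
Proof.
move=> oe md; exists (e \o widen_ord md); apply: orthonormal_lin_indep.
by apply: orthonormal_comp => // i j /(congr1 val) ij; apply: val_inj.
Qed.

(** * Projections of finite rank *)

Definition coord_proj (I : finType) (A : {set I}) (e : I -> H) (x : H) :=
  \sum_(i in A) ip x (e i) *: e i.

Section CoordProj.
Variables (I : finType) (A : {set I}) (e : I -> H).
Hypothesis oe : orthonormal e.

Lemma ip_coord_proj x y :
  ip (coord_proj A e x) y = \sum_(i in A) ip x (e i) * ip (e i) y.
Proof. by rewrite ip_suml; apply: eq_bigr => i _; rewrite ipZl. Qed.

Lemma ip_coord_proj_self x :
  ip (coord_proj A e x) x = \sum_(i in A) `|ip x (e i)| ^+ 2.
Proof. by rewrite ip_coord_proj; apply: eq_bigr => i _; rewrite sqr_norm_ip. Qed.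

Lemma coord_proj_fix T x : semilinear id T ->
  (forall i, i \in A -> T (e i) = e i) -> T (coord_proj A e x) = coord_proj A e x.
Proof.
move=> linT Te; rewrite (semilinear_sum linT); apply: eq_bigr => i iA.
by rewrite (semilinearZ linT) Te.
Qed.

Lemma coord_proj_linear : is_linear (coord_proj A e).
Proof.
move=> a x y; rewrite /coord_proj scaler_sumr -big_split /=; apply: eq_bigr => i _.
by rewrite ipDl ipZl scalerDl scalerA.
Qed.

Lemma coord_proj_basis j : coord_proj A e (e j) = (j \in A)%:R *: e j.
Proof.
rewrite /coord_proj; have [jA|jA] := boolP (j \in A).
  rewrite (bigD1 j) //= oe eqxx big1 ?addr0 // => i /andP[_ ij].
  by rewrite oe eq_sym (negPf ij) scale0r.
rewrite scale0r big1 // => i iA; rewrite oe; have [ji|_] := eqVneq j i.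
  by rewrite ji iA in jA.
by rewrite scale0r.
Qed.

Lemma coord_proj_projection : is_projection ip (coord_proj A e).
Proof.
apply: projection_of_idempotent => [|x|x y]; first exact: coord_proj_linear.
  apply: coord_proj_fix; first exact/is_linear_semilinear/coord_proj_linear.
  by move=> i iA; rewrite coord_proj_basis iA scale1r.
rewrite ip_coord_proj ip_sumr; apply: eq_bigr => i _.
by rewrite ipZr -ipC mulrC.
Qed.

Lemma ip_coord_proj_basis x j : ip (coord_proj A e x) (e j) = (j \in A)%:R * ip x (e j).
Proof.
rewrite (projection_adj coord_proj_projection) coord_proj_basis ipZr.
by case: (j \in A); rewrite ?conj1 ?conj0.
Qed.

Lemma bessel x : \sum_(i in A) `|ip x (e i)| ^+ 2 <= ip x x.
Proof.
rewrite -ip_coord_proj_self -(projection_ip coord_proj_projection).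
exact/projection_le/coord_proj_projection.
Qed.

Lemma coord_proj_isometry s V x : semilinear_isometry s V ->
  coord_proj A (V \o e) (V x) = V (coord_proj A e x).
Proof.
move=> isoV; have linV := isometry_semilinear isoV.
rewrite {2}/coord_proj (semilinear_sum linV); apply: eq_bigr => i _.
by rewrite (semilinearZ linV) (semilinear_isometry_ip isoV).
Qed.

Lemma coord_proj_rank : proj_rank ip #|A| (coord_proj A e).
Proof.
split; first exact: coord_proj_projection.
exists (fun i => e (enum_val i)); split; [|split].
- move=> i; apply/range_projection; first exact: coord_proj_projection.
  by rewrite coord_proj_basis enum_valP scale1r.
- exact/orthonormal_lin_indep/(orthonormal_comp enum_val_inj).
- move=> y [x ->]; exists (fun i => ip x (e (enum_val i))).
  by rewrite /coord_proj big_enum_val.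
Qed.

End CoordProj.

Lemma coord_proj_comp (I : finType) (A B : {set I}) (e : I -> H) x :
  orthonormal e ->
  coord_proj A e (coord_proj B e x) = coord_proj (A :&: B) e x.
Proof.
move=> oe; rewrite /coord_proj.
rewrite [RHS](eq_bigl (fun i => (i \in A) && (i \in B))); last first.
  by move=> i; rewrite inE.
rewrite big_mkcondr; apply: eq_bigr => i _; rewrite ip_coord_proj_basis //.
by case: (i \in B); rewrite ?mul1r // mul0r scale0r.
Qed.

Lemma orthonormal_extend n (f : 'I_n -> H) x : orthonormal f ->
  x != coord_proj setT f x ->
  exists a, orthonormal (fcons (a *: (x - coord_proj setT f x)) f).
Proof.
move=> of_; rewrite -subr_eq0 => /exists_unit[a _ resid_unit]; exists a.
apply: orthonormal_fcons => // i.
by rewrite ipZl ipBl ip_coord_proj_basis // inE mul1r subrr mulr0.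
Qed.

Lemma proj_rank_eq n P (f : 'I_n -> H) : proj_rank ip n P -> orthonormal f ->
  (forall i, P (f i) = f i) -> P = coord_proj setT f.
Proof.
move=> [projP [v [_ [_ span_v]]]] of_ Pf; have linP := projection_linear projP.
apply: projection_eq => //; first exact: coord_proj_projection.
  by move=> x; apply: coord_proj_fix.
move=> x; apply/esym/eqP/negPn/negP => /(orthonormal_extend of_)[a o_ext].
suff : (n.+1 <= n)%N by rewrite ltnn.
apply: (lin_indep_leq (w := v) (orthonormal_lin_indep o_ext)) => i.
apply/span_v/(range_projection projP); move: i.
apply: (fconsP (S := fun y => P y = y)) => //.
rewrite (projectionZ projP) (projectionB projP) (projection_idem projP).
by rewrite coord_proj_fix.
Qed.

Lemma proj_rank_basis n P : proj_rank ip n P ->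
  exists2 f : 'I_n -> H, orthonormal f & P = coord_proj setT f.
Proof.
move=> rP; have [projP [v [range_v [iv _]]]] := rP.
have [|//|f [of_ Pf _]] := @exists_orthonormal (fun u => P u = u) n _ n [::].
  move=> l; apply: (lin_indep_has_unit_orth projP iv) => i.
  exact/(range_projection projP).
by exists f => //; exact: proj_rank_eq.
Qed.

Lemma proj_rank_full n P : proj_rank ip n P -> ~ dim_ge H n.+1 -> forall x, P x = x.
Proof.
move=> rP ndim x; have [f of_ ->] := proj_rank_basis rP.
apply/esym/eqP/negPn/negP => /(orthonormal_extend of_)[a o_ext].
by apply: ndim; exact: orthonormal_dim_ge o_ext _.
Qed.

Lemma has_dim_of_dim_ge m : dim_ge H m -> ~ dim_ge H m.+1 -> has_dim H m.
Proof.
move=> dimH ndim.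
have [||f [of_ _ _]] := @exists_orthonormal (fun _ => True) m _ m [::] => //.
  by move=> l; exact: dim_ge_has_unit_orth.
exists f; split=> //; split; first exact: orthonormal_lin_indep.
move=> y _; exists (fun i => ip y (f i)).
have rf : proj_rank ip m (coord_proj setT f).
  by rewrite -{1}(card_ord m) -cardsT; exact: coord_proj_rank.
by rewrite -[LHS](proj_rank_full rf ndim); apply: eq_bigl => i; rewrite inE.
Qed.

(** * Principal angles *)

Definition commuting (P Q : H -> H) := forall x, P (Q x) = Q (P x).

Definition orth (P Q : H -> H) := forall x, P (Q x) = 0.

Lemma angle_eq_sym P Q P' Q' : angle_eq ip P' Q' P Q -> angle_eq ip P Q P' Q'.
Proof.
move=> [W [uW WT]]; have [W' uW' WK] := unitary_inv uW; exists W'; split=> // x.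
by have [_ _ /(_ x)[y ->]] := uW; rewrite -WT !WK.
Qed.

Lemma idempotent_QPQ_commuting P Q : is_projection ip P -> is_projection ip Q ->
  (forall x, Q (P (Q (Q (P (Q x))))) = Q (P (Q x))) -> commuting P Q.
Proof.
move=> projP projQ idem; pose T x := Q (P (Q x)).
have adjT x y : ip (T x) y = ip x (T y).
  by rewrite (projection_adj projQ) (projection_adj projP) (projection_adj projQ).
have PQ_T x : P (Q x) = T x.
  apply/esym/(projection_fixed projQ); rewrite (projection_ip projP).
  rewrite -(projection_ip projQ) -[RHS](projection_adj projQ) -/(T x) !adjT.
  by rewrite [T (T x)]idem.
have [adjP adjQ] := (projection_adj projP, projection_adj projQ).
by move=> x; rewrite PQ_T; exact/esym/(self_adjoint_comp adjP adjQ adjT PQ_T).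
Qed.

Lemma angle_eq_commuting P Q P' Q' : is_projection ip P -> is_projection ip Q ->
  is_projection ip P' -> is_projection ip Q' -> angle_eq ip P' Q' P Q ->
  commuting P Q -> commuting P' Q'.
Proof.
move=> projP projQ projP' projQ' [W [uW WT]] PQ.
have {}WT x : W (Q' (P' (Q' x))) = Q (P (Q (W x))) by exact: WT.
apply: idempotent_QPQ_commuting => // x.
apply: (semilinear_isometry_inj (unitary_isometry uW)).
by rewrite !WT -!PQ !(projection_idem projQ) (projection_idem projP).
Qed.

Lemma QPQ_eq0 P Q x : is_projection ip P -> is_projection ip Q ->
  Q (P (Q x)) = 0 -> P (Q x) = 0.
Proof.
move=> projP projQ QPQx; apply/eqP; rewrite -ip_eq0 (projection_ip projP).
by rewrite -(projection_adj projQ) QPQx ip0l.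
Qed.

Lemma angle_eq_orth P Q P' Q' : is_projection ip Q ->
  is_projection ip P' -> is_projection ip Q' -> angle_eq ip P' Q' P Q ->
  orth P Q -> orth P' Q'.
Proof.
move=> projQ projP' projQ' [W [uW WT]] PQ x; apply: (QPQ_eq0 projP' projQ').
apply: (semilinear_isometry_inj (unitary_isometry uW)).
by rewrite [LHS]WT /= PQ (projection0 projQ) (semilinear0 (unitary_linear uW)).
Qed.

(* The trace of the product of the projections onto the two spans. *)
Definition overlap (I J : finType) (A : {set I}) (e : I -> H)
    (B : {set J}) (f : J -> H) : K :=
  \sum_(i in A) \sum_(j in B) `|ip (e i) (f j)| ^+ 2.

Section Overlap.
Variables (I J : finType) (A : {set I}) (e : I -> H) (B : {set J}) (f : J -> H).

Lemma overlapC : overlap A e B f = overlap B f A e.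
Proof.
rewrite /overlap exchange_big; apply: eq_bigr => j _; apply: eq_bigr => i _.
by rewrite norm_ipC.
Qed.

Lemma overlapE : overlap A e B f = \sum_(i in A) ip (coord_proj B f (e i)) (e i).
Proof. by apply: eq_bigr => i _; rewrite ip_coord_proj_self. Qed.

Lemma overlap_eq0 i j : overlap A e B f = 0 -> i \in A -> j \in B -> ip (e i) (f j) = 0.
Proof.
move=> /eqP + iA jB; rewrite psumr_eq0 => [|k _]; last first.
  by apply: sumr_ge0 => *; rewrite exprn_ge0.
move=> /allP/(_ i); rewrite mem_index_enum iA => /(_ isT)/=.
rewrite psumr_eq0 => [|k _]; last by rewrite exprn_ge0.
move=> /allP/(_ j); rewrite mem_index_enum jB => /(_ isT)/=.
by rewrite sqrf_eq0 normr_eq0 => /eqP.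
Qed.

Lemma trace_basis_indep T : is_adjoint ip T T -> orthonormal e -> orthonormal f ->
  (forall x, T (coord_proj A e x) = T x) -> (forall x, T (coord_proj B f x) = T x) ->
  \sum_(i in A) ip (T (e i)) (e i) = \sum_(j in B) ip (T (f j)) (f j).
Proof.
move=> adjT oe of_ Te Tf.
have adj_f := projection_adj (coord_proj_projection B of_).
have T_range := self_adjoint_comp adjT adj_f adjT Tf.
transitivity (\sum_(i in A) \sum_(j in B) ip (T (e i)) (f j) * ip (f j) (e i)).
  by apply: eq_bigr => i _; rewrite -ip_coord_proj T_range.
rewrite exchange_big; apply: eq_bigr => j _.
rewrite -Te adjT ip_coord_proj; apply: eq_bigr => i _.
by rewrite mulrC adjT.
Qed.

End Overlap.

Lemma trace_QPQ (I J : finType) (A : {set I}) (e : I -> H)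
    (B : {set J}) (f : J -> H) :
  orthonormal f ->
  \sum_(j in B) ip (coord_proj B f (coord_proj A e (coord_proj B f (f j)))) (f j) =
  overlap A e B f.
Proof.
move=> of_; rewrite overlapC overlapE; apply: eq_bigr => j jB.
by rewrite (projection_adj (coord_proj_projection B of_)) coord_proj_basis // jB scale1r.
Qed.

Lemma overlap_basis (I : finType) (A B : {set I}) (e : I -> H) : orthonormal e ->
  overlap A e B e = #|A :&: B|%:R.
Proof.
move=> oe; rewrite overlapE -sum1_card natr_sum.
rewrite [RHS](eq_bigl (fun i => (i \in A) && (i \in B))) => [|i]; last by rewrite inE.
rewrite big_mkcondr; apply: eq_bigr => i _.
by rewrite ip_coord_proj_basis // oe eqxx mulr1; case: (i \in B).
Qed.

Lemma overlap_angle_eq (I J I' J' : finType) (A : {set I}) (e : I -> H)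
    (B : {set J}) (f : J -> H) (A' : {set I'}) (e' : I' -> H)
    (B' : {set J'}) (f' : J' -> H) :
  orthonormal e -> orthonormal f -> orthonormal e' -> orthonormal f' ->
  angle_eq ip (coord_proj A' e') (coord_proj B' f') (coord_proj A e) (coord_proj B f) ->
  overlap A' e' B' f' = overlap A e B f.
Proof.
move=> oe of_ oe' of' [W [uW WT]]; have isoW := unitary_isometry uW.
have projP := coord_proj_projection A oe; have projQ := coord_proj_projection B of_.
pose T := coord_proj B f \o coord_proj A e \o coord_proj B f.
rewrite -!trace_QPQ //.
transitivity (\sum_(j in B') ip (T ((W \o f') j)) ((W \o f') j)).
  by apply: eq_bigr => j _; rewrite -(unitary_ip uW) WT.
apply: trace_basis_indep; [| exact: orthonormal_isometry isoW of' | exact: of_ | |].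
- move=> x y; rewrite /T /= (projection_adj projQ) (projection_adj projP).
  by rewrite (projection_adj projQ).
- move=> x; have [_ _ /(_ x)[y ->]] := uW.
  rewrite (coord_proj_isometry _ _ _ isoW) /T -!WT /=.
  by rewrite (projection_idem (coord_proj_projection B' of')).
- by move=> x; rewrite /T /= (projection_idem projQ).
Qed.

(** * Joint eigenbases of commuting projections *)

Section JointBasis.
Variables (J : finType) (n : nat) (Q : J -> H -> H).
Hypothesis rank_Q : forall j, proj_rank ip n (Q j).
Hypothesis comm_Q : forall i j, commuting (Q i) (Q j).

Let projQ j : is_projection ip (Q j). Proof. by case: (rank_Q j). Qed.

Definition joint_eigenvector (w : H) := forall j, Q j w = 0 \/ Q j w = w.

Definition invariant_pred (G : H -> Prop) := forall j y, G y -> G (Q j y).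

Lemma exists_joint_eigenvector z : z != 0 ->
  exists w, [/\ w != 0, joint_eigenvector w &
    forall G, invariant_pred G -> G z -> G w].
Proof.
move=> z_neq0; suff [w [w_neq0 w_eig Gw]] : exists w, [/\ w != 0,
    {in enum J, forall j, Q j w = 0 \/ Q j w = w} &
    forall G, invariant_pred G -> G z -> G w].
  by exists w; split=> // j; apply: w_eig; rewrite mem_enum.
elim: (enum J) => [|j s [w [w_neq0 ws Gw]]]; first by exists z; split.
have [Qw0|Qw0] := eqVneq (Q j w) 0.
  exists w; split=> // i; rewrite inE => /orP[/eqP->|]; [by left | exact: ws].
exists (Q j w); split=> // [i|G GQ Gz]; last exact/GQ/(Gw G).
rewrite inE => /orP[/eqP->|/ws]; first by right; rewrite (projection_idem (projQ j)).
by rewrite comm_Q => -[] ->; [left; rewrite (projection0 (projQ j)) | right].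
Qed.

Definition eigen_family d (e : 'I_d -> H) :=
  [/\ orthonormal e, forall k, joint_eigenvector (e k) &
      forall k, exists j, Q j (e k) = e k].

Lemma joint_eigenvector_scale a w : joint_eigenvector w -> joint_eigenvector (a *: w).
Proof.
move=> w_eig j; rewrite (projectionZ (projQ j)).
by case: (w_eig j) => ->; [left; rewrite scaler0 | right].
Qed.

Lemma eigen_family_extend d (e : 'I_d -> H) w j : eigen_family e -> w != 0 ->
  joint_eigenvector w -> Q j w = w -> (forall k, ip w (e k) = 0) ->
  exists e' : 'I_d.+1 -> H, eigen_family e'.
Proof.
move=> [oe e_eig e_range] w_neq0 w_eig Qw we; have [a _ aw_unit] := exists_unit w_neq0.
exists (fcons (a *: w) e); split.
- by apply: orthonormal_fcons => // k; rewrite ipZl we mulr0.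
- by apply: (fconsP (S := joint_eigenvector)); first exact: joint_eigenvector_scale.
- apply: (fconsP (S := fun y => exists j, Q j y = y)) => //.
  by exists j; rewrite (projectionZ (projQ j)) Qw.
Qed.

Lemma eigen_family_leq d (e : 'I_d -> H) : eigen_family e -> (d <= #|J| * n)%N.
Proof.
move=> [oe _ e_range]; rewrite -(ler_nat K).
apply: (@le_trans _ _ (\sum_(k < d) \sum_j ip (Q j (e k)) (e k))).
  rewrite -{1}(card_ord d) -sum1_card natr_sum; apply: ler_sum => k _.
  have [j Qj] := e_range k; rewrite (bigD1 j) //= Qj (orthonormal_unit k oe) lerDl.
  by apply: sumr_ge0 => i _; rewrite -(projection_ip (projQ i)) ip_ge0.
rewrite exchange_big /= natrM mulr_natl -sumr_const; apply: ler_sum => j _.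
have [f of_ ->] := proj_rank_basis (rank_Q j).
rewrite (eq_bigl (fun k => k \in [set: 'I_d])) => [|k]; last by rewrite inE.
rewrite -overlapE overlapC /overlap -[X in _ <= X%:R](card_ord n) -sum1_card natr_sum.
rewrite [leLHS](eq_bigl predT) => [|i]; last by rewrite inE.
by apply: ler_sum => i _; rewrite -[1%:R](orthonormal_unit i of_); exact: bessel.
Qed.

Lemma exists_max_eigen_family : exists d (e : 'I_d -> H),
  eigen_family e /\ forall e' : 'I_d.+1 -> H, ~ eigen_family e'.
Proof.
pose eigen_dim d := `[< exists e : 'I_d -> H, eigen_family e >].
have ex_eigen_dim : exists d, eigen_dim d.
  by exists 0%N; apply/asboolP; exists (fun _ => 0); split; case.
have eigen_dim_leq d : eigen_dim d -> (d <= #|J| * n)%N.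
  by move/asboolP => [e /eigen_family_leq].
case: (ex_maxnP ex_eigen_dim eigen_dim_leq) => d /asboolP[e eig_e] max_d.
exists d, e; split=> // e' eig_e'; suff /max_d : eigen_dim d.+1 by rewrite ltnn.
by apply/asboolP; exists e'.
Qed.

Lemma joint_eigenbasis : exists d (e : 'I_d -> H) (F : J -> {set 'I_d}),
  orthonormal e /\ forall j, Q j = coord_proj (F j) e.
Proof.
have [d [e [eig_e e_max]]] := exists_max_eigen_family; have [oe e_eig _] := eig_e.
exists d, e, (fun j => [set k | `[< Q j (e k) = e k >]]); split=> // j.
set A := [set k | _]; have projA := coord_proj_projection A oe.
have QA x : Q j (coord_proj A e x) = coord_proj A e x.
  apply: coord_proj_fix => [|k]; first exact: projection_linear.
  by rewrite inE => /asboolP.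
apply: projection_eq => // x; apply/eqP; rewrite -subr_eq0; apply/negPn/negP.
set z := _ - _ => z_neq0.
have Qz : Q j z = z by rewrite (projectionB (projQ j)) QA (projection_idem (projQ j)).
have ze k : ip z (e k) = 0.
  case: (e_eig k j) => Qek; first exact: projection_orth (projQ j) _ _ Qz Qek.
  by rewrite ipBl ip_coord_proj_basis // inE asboolT // mul1r subrr.
have [w [w_neq0 w_eig Gw]] := exists_joint_eigenvector z_neq0.
have Qw : Q j w = w.
  by apply: (Gw (fun y => Q j y = y)) => // i y Qy; rewrite comm_Q Qy.
have we : forall k, ip w (e k) = 0.
  apply: (Gw (fun y => forall k, ip y (e k) = 0)) => // i y ye k.
  by rewrite (projection_adj (projQ i)); case: (e_eig k i) => ->; rewrite ?ip0r.
by have [e' /e_max] := eigen_family_extend eig_e w_neq0 w_eig Qw we.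
Qed.

End JointBasis.

(** * Angle-preserving maps in finite rank *)

Lemma sum_weight_overlap (I J L M : finType) (a : I -> K) (b : J -> K)
    (F : I -> {set L}) (G : J -> {set M}) (e : L -> H) (f : M -> H) :
  \sum_i a i * (\sum_j b j * overlap (F i) e (G j) f) =
  \sum_l weight a F l * (\sum_m weight b G m * `|ip (e l) (f m)| ^+ 2).
Proof.
rewrite -sum_weight; apply: eq_bigr => i _; congr (_ * _).
under eq_bigr => j _ do rewrite overlapC.
rewrite sum_weight exchange_big; apply: eq_bigr => m _; rewrite -mulr_sumr.
by congr (_ * _); apply: eq_bigr => l _; rewrite norm_ipC.
Qed.

Lemma exists_orthonormal_meeting n (X : 'I_n.+1 -> H) :
  orthonormal X -> dim_ge H (n + n).+1 ->
  exists Y : 'I_n.+1 -> H,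
    [/\ orthonormal Y, Y ord0 = X ord0 & forall i j, ip (X i) (Y (lift ord0 j)) = 0].
Proof.
move=> oX dimH.
have [||f [of_ _ fX]] := @exists_orthonormal (fun _ => True) (n + n).+1 _ n (codom X).
- by move=> l; exact: dim_ge_has_unit_orth.
- by rewrite size_codom card_ord; lia.
have Xf i j : ip (X i) (f j) = 0 by apply/ip_sym0/fX; exact: codom_f.
exists (fcons (X ord0) f); split; last 2 first.
- exact: fcons0.
- by move=> i j; rewrite fconsS.
by apply: orthonormal_fcons => //; exact: orthonormal_unit.
Qed.

Section FiniteRank.
Variables (n : nat) (phi : (H -> H) -> (H -> H)).
Hypothesis n_gt0 : (0 < n)%N.
Hypothesis phi_rank : forall P, proj_rank ip n P -> proj_rank ip n (phi P).
Hypothesis phi_angle : forall P Q, proj_rank ip n P -> proj_rank ip n Q ->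
  angle_eq ip (phi P) (phi Q) P Q.

Lemma phi_overlap (I J I' J' : finType) (A : {set I}) (e : I -> H)
    (B : {set J}) (f : J -> H) (A' : {set I'}) (e' : I' -> H)
    (B' : {set J'}) (f' : J' -> H) :
  orthonormal e -> orthonormal f -> orthonormal e' -> orthonormal f' ->
  #|A| = n -> #|B| = n ->
  phi (coord_proj A e) = coord_proj A' e' -> phi (coord_proj B f) = coord_proj B' f' ->
  overlap A' e' B' f' = overlap A e B f.
Proof.
move=> oe of_ oe' of' card_A card_B phiA phiB; apply: overlap_angle_eq => //.
by rewrite -phiA -phiB; apply: phi_angle; [rewrite -card_A | rewrite -card_B];
  exact: coord_proj_rank.
Qed.

Definition omit (i : 'I_n.+1) : {set 'I_n.+1} := [set~ i].

Lemma card_omit i : #|omit i| = n.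
Proof. by rewrite cardsC1 card_ord. Qed.

Definition frame (X : 'I_n.+1 -> H) d (e : 'I_d -> H) (F : 'I_n.+1 -> {set 'I_d}) :=
  [/\ orthonormal X, orthonormal e &
      forall i, phi (coord_proj (omit i) X) = coord_proj (F i) e].

Lemma exists_frame X : orthonormal X -> exists d (e : 'I_d -> H) F, frame X e F.
Proof.
move=> oX.
have rX i : proj_rank ip n (coord_proj (omit i) X).
  by have := coord_proj_rank (omit i) oX; rewrite card_omit.
have [||d [e [F [oe eF]]]] :=
    @joint_eigenbasis _ n (fun i => phi (coord_proj (omit i) X)).
- by move=> i; exact: phi_rank.
- move=> i j; apply: angle_eq_commuting (phi_angle (rX i) (rX j)) _.
  1-2: by case: (rX i); case: (rX j).
  1-2: by case: (phi_rank (rX i)); case: (phi_rank (rX j)).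
  by move=> x; rewrite !coord_proj_comp // setIC.
by exists d, e, F.
Qed.

Lemma frame_overlap X d (e : 'I_d -> H) F Y d' (f : 'I_d' -> H) G i j :
  frame X e F -> frame Y f G ->
  overlap (F i) e (G j) f = overlap (omit i) X (omit j) Y.
Proof. by move=> [oX oe eF] [oY of_ fG]; apply: phi_overlap; rewrite ?card_omit. Qed.

(* The combination of the projections [coord_proj (omit i) X] with these
   coefficients is [n] times the projection onto the line of [X ord0]. *)
Definition line_coef (i : 'I_n.+1) : K := 1 - n%:R * (i == ord0)%:R.

Lemma weight_line_coef d (F : 'I_n.+1 -> {set 'I_d}) l :
  weight line_coef F l = (degree F l)%:R - n%:R * (l \in F ord0)%:R.
Proof.
rewrite /weight big_split /= /degree -sum1dep_card natr_sum sumrN; congr (_ - _).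
rewrite big_mkcond (bigD1 ord0) //= big1 ?addr0 => [|i /negPf->].
  by case: (_ \in _); rewrite ?mulr1 ?mulr0.
by rewrite mulr0; case: ifP.
Qed.

Definition concentrated d (F : 'I_n.+1 -> {set 'I_d}) (k : 'I_d) :=
  forall l, weight line_coef F l = n%:R * (l == k)%:R.

Lemma weight_line_coef_omit (l : 'I_n.+1) :
  weight line_coef omit l = n%:R * (l == ord0)%:R.
Proof.
rewrite weight_line_coef (_ : degree omit l = n); last first.
  by rewrite -[RHS](card_omit l); apply: eq_card => i; rewrite !inE eq_sym.
by rewrite !inE; case: (l == ord0); rewrite ?mulr0 ?mulr1 ?subr0 ?subrr.
Qed.

Lemma frame_pairing X d (e : 'I_d -> H) F Y d' (f : 'I_d' -> H) G :
  frame X e F -> frame Y f G ->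
  \sum_l weight line_coef F l * (\sum_m weight line_coef G m * `|ip (e l) (f m)| ^+ 2) =
  n%:R * (n%:R * `|ip (X ord0) (Y ord0)| ^+ 2).
Proof.
move=> frX frY; rewrite -sum_weight_overlap.
under eq_bigr => i _ do under eq_bigr => j _ do rewrite (frame_overlap i j frX frY).
rewrite sum_weight_overlap.
under eq_bigr => l _ do under eq_bigr => m _ do rewrite weight_line_coef_omit.
under eq_bigr => l _ do rewrite sum_scaled_indicator weight_line_coef_omit.
exact: sum_scaled_indicator.
Qed.

Lemma frame_form X d (e : 'I_d -> H) F P : frame X e F -> proj_rank ip n P ->
  \sum_l weight line_coef F l * ip (phi P (e l)) (e l) = n%:R * ip (P (X ord0)) (X ord0).
Proof.
move=> [oX oe eF] rP; have [f of_ eP] := proj_rank_basis rP.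
have [f' of' eP'] := proj_rank_basis (phi_rank rP).
rewrite eP' -sum_weight; under eq_bigr => i _ do rewrite -overlapE.
transitivity (\sum_i line_coef i * overlap (omit i) X setT f).
  apply: eq_bigr => i _; congr (_ * _).
  by apply: phi_overlap; rewrite ?card_omit ?cardsT ?card_ord // -eP.
under eq_bigr => i _ do rewrite overlapE.
rewrite sum_weight -eP; under eq_bigr => l _ do rewrite weight_line_coef_omit.
exact: sum_scaled_indicator.
Qed.

Section FrameFamily.
Variables (X : 'I_n.+1 -> H) (d : nat) (e : 'I_d -> H) (F : 'I_n.+1 -> {set 'I_d}).
Hypothesis frX : frame X e F.

Lemma frame_cardI i j : #|F i :&: F j| = #|omit i :&: omit j|.
Proof.
have [oX oe _] := frX; have := frame_overlap i j frX frX; rewrite !overlap_basis //.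
by move/eqP; rewrite eqr_nat => /eqP.
Qed.

Lemma frame_card i : #|F i| = n.
Proof. by rewrite -(setIid (F i)) frame_cardI setIid card_omit. Qed.

Lemma frame_card_meet i j : i != j -> #|F i :&: F j| = n.-1.
Proof.
by move=> ij; rewrite frame_cardI -setCU cardsCs setCK card_ord cards2 ij subSS subn1.
Qed.

Lemma frame_sum_degree_off : (\sum_(l in ~: F ord0) degree F l = n)%N.
Proof. exact: sum_degree_off (card_ord _) n_gt0 frame_card frame_card_meet. Qed.

Lemma star_frame_card : is_star F ord0 -> (n + n <= d)%N.
Proof.
rewrite -[X in _ -> (_ <= X)%N](card_ord d).
exact: star_family_card (card_ord _) n_gt0 frame_card frame_card_meet.
Qed.

Lemma frame_dichotomy : (exists k, concentrated F k) \/ is_star F ord0.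
Proof.
have [[k deg_F]|star] :=
    family_dichotomy ord0 (card_ord _) n_gt0 frame_card frame_card_meet.
- by left; exists k => l; rewrite weight_line_coef deg_F natrM natrD; ring.
- by right.
Qed.

Lemma frame_atom_rank1 : n = 1%N -> exists k, concentrated F k.
Proof.
move=> n1; have [lt1n natr_n] : (1 < n.+1)%N /\ n%:R = 1 :> K by rewrite n1.
pose other : 'I_n.+1 := Ordinal lt1n.
have [k Fk] : exists k, F other = [set k] by apply/cards1P; rewrite frame_card n1.
exists k => l; rewrite weight_line_coef /degree -sum1dep_card big_mkcond.
rewrite (bigD1 ord0) //= (bigD1 other) //= big1 => [|i /andP[]]; last first.
  by rewrite -!val_eqE /=; have := ltn_ord i; move: n1; lia.
by rewrite Fk inE natr_n !mul1r; case: (l \in F ord0); case: (l == k) => /=; ring.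
Qed.

Lemma star_weight_le1 : is_star F ord0 -> forall l, weight line_coef F l <= 1.
Proof.
move=> star l; rewrite weight_line_coef lerBlDr.
have [_|lF] := boolP (l \in F ord0); last by rewrite mulr0 addr0 (ler_nat K _ 1) star.
rewrite mulr1 -(natrD _ 1) ler_nat add1n -[X in (_ <= X)%N](card_ord n.+1).
exact: max_card.
Qed.

End FrameFamily.

(* If [Y] meets the span of [X] in [X ord0] only, then the pairing of the frames
   is at most [n] for a star, while [frame_pairing] evaluates it to [n ^ 2]. *)
Lemma star_frame_pairing_le X d (e : 'I_d -> H) F Y d' (f : 'I_d' -> H) G :
  frame X e F -> frame Y f G -> (forall l, weight line_coef F l <= 1) ->
  (forall i j, ip (X i) (Y (lift ord0 j)) = 0) ->
  \sum_l weight line_coef F l * (\sum_m weight line_coef G m * `|ip (e l) (f m)| ^+ 2)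
    <= n%:R.
Proof.
move=> frX frY weight_le1 XY; have [_ oe _] := frX; have [_ of_ _] := frY.
have ef0 i l m : l \in F i -> m \in G ord0 -> ip (e l) (f m) = 0.
  apply: overlap_eq0; rewrite (frame_overlap i ord0 frX frY) /overlap big1 // => k _.
  rewrite big1 // => j; rewrite !inE; case: (unliftP ord0 j) => [j'|] -> //= _.
  by rewrite XY normr0 expr0n.
under eq_bigr => l _ do rewrite mulr_sumr.
rewrite exchange_big /= (bigID (mem (G ord0))) /= big1 ?add0r => [|m mG]; last first.
  rewrite big1 // => l _.
  have [/existsP[i lF]|/existsPn lF] := boolP [exists i, l \in F i].
    by rewrite (ef0 i l m) // normr0 expr0n !mulr0.
  by rewrite /weight big_pred0 ?mul0r // => i; apply/negbTE/lF.
rewrite -[X in _ <= X%:R](frame_sum_degree_off frY) natr_sum.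
rewrite [X in _ <= X](eq_bigl (fun m => m \notin G ord0)) => [|m]; last by rewrite inE.
apply: ler_sum => m mG; rewrite [weight _ G m]weight_line_coef (negPf mG) mulr0 subr0.
under eq_bigr => l _ do rewrite mulrCA.
rewrite -mulr_sumr -[X in _ <= X]mulr1; apply: ler_wpM2l; first by rewrite ler0n.
apply: le_trans (_ : ip (f m) (f m) <= _); last by rewrite (orthonormal_unit m of_).
apply: le_trans (bessel [set: 'I_d] oe (f m)).
rewrite [X in _ <= X](eq_bigl predT) => [|l]; last by rewrite inE.
apply: ler_sum => l _; rewrite norm_ipC -[X in _ <= X]mul1r.
by apply: ler_wpM2r; rewrite ?exprn_ge0.
Qed.

Lemma star_frame_dim X d (e : 'I_d -> H) F : frame X e F -> (1 < n)%N ->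
  is_star F ord0 -> ~ dim_ge H (n + n).+1.
Proof.
move=> frX n_gt1 star dimH; have [oX _ _] := frX.
have [Y [oY Y0 XY]] := exists_orthonormal_meeting oX dimH.
have [d' [f [G frY]]] := exists_frame oY.
have := star_frame_pairing_le frX frY (star_weight_le1 star) XY.
rewrite (frame_pairing frX frY) Y0 (orthonormal_unit ord0 oX) normr1 expr1n mulr1.
by rewrite -natrM ler_nat; move: n_gt1; clear; nia.
Qed.

Hypothesis dimH : n = 1%N \/ (dim_ge H (n + n).+1 \/ ~ dim_ge H (n + n)).

Lemma frame_atom X d (e : 'I_d -> H) F : frame X e F -> exists k, concentrated F k.
Proof.
move=> frX; have [_ oe _] := frX; have [//|star] := frame_dichotomy frX.
case: dimH => [n1|[dim_gt|dim_lt]]; first exact: frame_atom_rank1 frX n1.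
  have [n1|n_neq1] := eqVneq n 1%N; first exact: frame_atom_rank1 frX n1.
  have n_gt1 : (1 < n)%N by lia.
  by case: (star_frame_dim frX n_gt1 star).
by case: dim_lt; exact: orthonormal_dim_ge oe (star_frame_card frX star).
Qed.

Definition frame_line (x u : H) := exists X d (e : 'I_d -> H) F k,
  [/\ frame X e F, X ord0 = x, u = e k & concentrated F k].

Lemma exists_frame_line x : dim_ge H n.+1 -> unit_vector x -> exists u, frame_line x u.
Proof.
move=> dimS x_unit.
have [||f [of_ _ fx]] := @exists_orthonormal (fun _ => True) n.+1 _ n [:: x].
- by move=> l; exact: dim_ge_has_unit_orth.
- by rewrite /= add1n.
have oX : orthonormal (fcons x f).
  by apply: orthonormal_fcons => // i; apply/ip_sym0/fx/mem_head.
have [d [e [F fr]]] := exists_frame oX; have [k wk] := frame_atom fr.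
by exists (e k), (fcons x f), d, e, F, k; split=> //; exact: fcons0.
Qed.

Let natr_n_neq0 : n%:R != 0 :> K. Proof. by rewrite pnatr_eq0 -lt0n. Qed.

Lemma frame_line_norm_ip x y u v : frame_line x u -> frame_line y v ->
  `|ip u v| = `|ip x y|.
Proof.
move=> [X [d [e [F [k [frX <- -> wF]]]]]] [Y [d' [f [G [m [frY <- -> wG]]]]]].
have := frame_pairing frX frY.
under eq_bigr => l _ do under eq_bigr => j _ do rewrite wG.
under eq_bigr => l _ do rewrite sum_scaled_indicator wF.
rewrite sum_scaled_indicator => /(mulfI natr_n_neq0)/(mulfI natr_n_neq0)/eqP.
by rewrite eqrXn2 // => /eqP.
Qed.

Lemma frame_line_fixed x u P : frame_line x u -> proj_rank ip n P ->
  P x = x -> phi P u = u.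
Proof.
move=> [X [d [e [F [k [frX <- -> wF]]]]]] rP Px; have [oX oe _] := frX.
have [projP' _] := phi_rank rP; apply: (projection_fixed projP').
have := frame_form frX rP; under eq_bigr => l _ do rewrite wF.
rewrite sum_scaled_indicator Px => /(mulfI natr_n_neq0) ->.
by rewrite (orthonormal_unit k oe) (orthonormal_unit ord0 oX).
Qed.

Lemma exists_finite_line_map : dim_ge H n.+1 -> exists chi : H -> H,
  (forall x y, unit_vector x -> unit_vector y -> `|ip (chi x) (chi y)| = `|ip x y|) /\
  (forall P x, proj_rank ip n P -> unit_vector x -> P x = x -> phi P (chi x) = chi x).
Proof.
move=> dimS.
have /choice[chi chiP] x : exists u, unit_vector x -> frame_line x u.
  have [/(exists_frame_line dimS)[u]|not_unit] := pselect (unit_vector x).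
    by exists u.
  by exists 0.
exists chi; split=> [x y x_unit y_unit|P x rP x_unit].
  by apply: frame_line_norm_ip; exact: chiP.
by apply: frame_line_fixed => //; exact: chiP.
Qed.

End FiniteRank.

(** * Wigner's theorem *)

Section Wigner.
Variables (T : H -> H) (e : H).
Hypothesis T_norm_ip : forall x y, `|ip (T x) (T y)| = `|ip x y|.
Hypothesis e_unit : unit_vector e.

Lemma wigner_ip_self x : ip (T x) (T x) = ip x x.
Proof. by rewrite -[LHS]ger0_norm ?ip_ge0 // T_norm_ip ger0_norm ?ip_ge0. Qed.

Lemma wigner_neq0 x : x != 0 -> T x != 0.
Proof. by rewrite -!ip_eq0 wigner_ip_self. Qed.

Lemma wigner_scale a x : exists c, T (a *: x) = c *: T x.
Proof.
have [->|/wigner_neq0 Tx_neq0] := eqVneq x 0.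
  by rewrite scaler0; exists 1; rewrite scale1r.
exists (ip (T (a *: x)) (T x) / ip (T x) (T x)); apply: cauchy_schwarz_eq => //.
by rewrite T_norm_ip !wigner_ip_self sqr_norm_ip !(ipZl, ipZr); ring.
Qed.

(* [T e + offset z] is the vector on the line of [T (e + z)] whose component
   along [T e] is [T e] itself. *)
Definition offset (z : H) := (ip (T (e + z)) (T e))^-1 *: T (e + z) - T e.

Lemma offset_line z : ip z e = 0 ->
  exists2 c, `|c| = 1 & T e + offset z = c *: T (e + z).
Proof.
move=> ze; exists (ip (T (e + z)) (T e))^-1; last by rewrite addrC subrK.
by rewrite normfV T_norm_ip ipDl ze addr0 e_unit normr1 invr1.
Qed.

Lemma ip_offset_base z : ip z e = 0 -> ip (offset z) (T e) = 0.
Proof.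
move=> ze; rewrite ipBl ipZl wigner_ip_self e_unit mulVf ?subrr //.
by rewrite -normr_eq0 T_norm_ip ipDl ze addr0 e_unit normr1 oner_neq0.
Qed.

Lemma norm_1D_ip_offset z w : ip z e = 0 -> ip w e = 0 ->
  `|1 + ip (offset z) (offset w)| = `|1 + ip z w|.
Proof.
move=> ze we; have Te_unit : unit_vector (T e) by rewrite /unit_vector wigner_ip_self.
rewrite -(ip_unitD Te_unit (ip_offset_base ze) (ip_offset_base we)).
have [c norm_c ->] := offset_line ze; have [d norm_d ->] := offset_line we.
by rewrite ipZl ipZr !normrM norm_conj norm_c norm_d !mul1r T_norm_ip ip_unitD.
Qed.

Lemma ip_offset_self z : ip z e = 0 -> ip (offset z) (offset z) = ip z z.
Proof.
move=> ze; have := norm_1D_ip_offset ze ze.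
by rewrite !ger0_norm ?addr_ge0 ?ip_ge0 // => /addrI.
Qed.

Lemma offset0 : offset 0 = 0.
Proof. by apply/eqP; rewrite -ip_eq0 ip_offset_self ip0l. Qed.

Lemma norm_ip_offset_T z : ip z e = 0 -> `|ip (offset z) (T z)| = ip z z.
Proof.
move=> ze; have Te_Tz : ip (T e) (T z) = 0.
  by apply/eqP; rewrite -normr_eq0 T_norm_ip (ip_sym0 ze) normr0.
have -> : ip (offset z) (T z) = ip (T e + offset z) (T z) by rewrite ipDl Te_Tz add0r.
have [c norm_c ->] := offset_line ze.
by rewrite ipZl normrM norm_c mul1r T_norm_ip ipDl (ip_sym0 ze) add0r ger0_norm ?ip_ge0.
Qed.

Lemma offset_scale z : ip z e = 0 -> exists2 c, `|c| = 1 & offset z = c *: T z.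
Proof.
move=> ze; have [->|z_neq0] := eqVneq z 0.
  exists 1; first by rewrite normr1.
  by apply/esym/eqP; rewrite offset0 scale1r -ip_eq0 wigner_ip_self ip0l.
exists (ip (offset z) (T z) / ip (T z) (T z)).
  rewrite normrM normfV norm_ip_offset_T // wigner_ip_self ger0_norm ?ip_ge0 //.
  by rewrite divff // ip_eq0.
apply: cauchy_schwarz_eq; first exact: wigner_neq0.
by rewrite norm_ip_offset_T // wigner_ip_self ip_offset_self // expr2.
Qed.

Lemma norm_ip_offset z w : ip z e = 0 -> ip w e = 0 ->
  `|ip (offset z) (offset w)| = `|ip z w|.
Proof.
move=> /offset_scale[c norm_c ->] /offset_scale[d norm_d ->].
by rewrite ipZl ipZr !normrM norm_conj norm_c norm_d !mul1r T_norm_ip.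
Qed.

Lemma ip_offset_re z w : ip z e = 0 -> ip w e = 0 ->
  ip (offset z) (offset w) + ip (offset w) (offset z) = ip z w + ip w z.
Proof.
move=> ze we; have := congr1 (fun c => c ^+ 2) (norm_1D_ip_offset ze we).
rewrite -!(mul_conj cK) !(conjD cK) conj1 -!ipC => sqr_1D.
have := congr1 (fun c => c ^+ 2) (norm_ip_offset ze we); rewrite !sqr_norm_ip => sqr_ip.
apply: (addrI 1); apply: (addIr (ip z w * ip w z)); rewrite -{1}sqr_ip.
transitivity ((1 + ip (offset z) (offset w)) * (1 + ip (offset w) (offset z))).
  by ring.
by rewrite sqr_1D; ring.
Qed.

Lemma double_ip_real_comb a p q r : conj a = a ->
  2 * ip (p - a *: q - r) (p - a *: q - r) =
  (ip p p + ip p p) - 2 * a * (ip p q + ip q p) - 2 * (ip p r + ip r p) +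
  a ^+ 2 * (ip q q + ip q q) + 2 * a * (ip q r + ip r q) + (ip r r + ip r r).
Proof. by move=> a_real; rewrite !(ipBl, ipBr, ipZl, ipZr) a_real; ring. Qed.

Lemma offset_real_linear a z w : conj a = a -> ip z e = 0 -> ip w e = 0 ->
  offset (a *: z + w) = a *: offset z + offset w.
Proof.
move=> a_real ze we.
have ue : ip (a *: z + w) e = 0 by rewrite ipDl ipZl ze we mulr0 addr0.
have two_neq0 : 2 != 0 :> K by rewrite pnatr_eq0.
apply/eqP; rewrite -subr_eq0 opprD addrA -ip_eq0 -(inj_eq (mulfI two_neq0)) mulr0.
rewrite double_ip_real_comb // !ip_offset_re // -double_ip_real_comb //.
by rewrite -addrA -opprD subrr ip0l mulr0.
Qed.

Lemma offsetD z w : ip z e = 0 -> ip w e = 0 -> offset (z + w) = offset z + offset w.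
Proof. by move=> ze we; have := offset_real_linear conj1 ze we; rewrite !scale1r. Qed.

Lemma offset_realZ a z : conj a = a -> ip z e = 0 -> offset (a *: z) = a *: offset z.
Proof.
move=> a_real ze; have := offset_real_linear a_real ze (ip0l e).
by rewrite offset0 !addr0.
Qed.

Section ImaginaryUnit.
Variable j : K.
Hypothesis j_sqr : j * j = -1.
Hypothesis j_conj : conj j = - j.

Let orth_j z : ip z e = 0 -> ip (j *: z) e = 0.
Proof. by move=> ze; rewrite ipZl ze mulr0. Qed.

Lemma offset_imagZ z : ip z e = 0 ->
  offset (j *: z) = j *: offset z \/ offset (j *: z) = - j *: offset z.
Proof.
move=> ze; have [->|z_neq0] := eqVneq z 0.
  by left; rewrite scaler0 offset0 scaler0.
have zz_neq0 : ip z z != 0 by rewrite ip_eq0.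
have norm_j : `|j| = 1.
  apply/eqP; rewrite -(eqrXn2 (n := 2)) // -(mul_conj cK) j_conj mulrN j_sqr.
  by rewrite opprK expr1n.
set c := ip (offset (j *: z)) (offset z).
have norm_c : `|c| = ip z z.
  by rewrite norm_ip_offset ?orth_j // ipZl normrM norm_j mul1r ger0_norm ?ip_ge0.
have conj_c : conj c = - c.
  apply/eqP; rewrite -addr_eq0 addrC /c -ipC ip_offset_re ?orth_j //.
  by rewrite ipZl ipZr j_conj; apply/eqP; ring.
have offset_jz : offset (j *: z) = (c / ip z z) *: offset z.
  rewrite -(ip_offset_self ze); apply: cauchy_schwarz_eq.
    by rewrite -ip_eq0 ip_offset_self.
  rewrite -/c norm_c !ip_offset_self ?orth_j // ipZl ipZr j_conj mulrA mulrN.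
  by rewrite j_sqr opprK mul1r expr2.
have : (c - j * ip z z) * (c + j * ip z z) = 0.
  have := mul_conj cK c; rewrite conj_c norm_c => c_sqr.
  transitivity (- (c * - c) - j * j * ip z z ^+ 2); first by ring.
  by rewrite c_sqr j_sqr; ring.
move/eqP; rewrite mulf_eq0 subr_eq0 addr_eq0 => /orP[]/eqP c_eq; [left|right].
  by rewrite offset_jz c_eq mulfK.
by rewrite offset_jz c_eq -mulNr mulfK.
Qed.

(* If the sign differed at [z] and at [w], it would be undetermined at [z + w]. *)
Lemma offset_imagZ_uniform :
  (forall z, ip z e = 0 -> offset (j *: z) = j *: offset z) \/
  (forall z, ip z e = 0 -> offset (j *: z) = - j *: offset z).
Proof.
have [|/existsNP[z /not_implyP[ze not_pos]]] :=
    pselect (forall z, ip z e = 0 -> offset (j *: z) = j *: offset z); first by left.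
have neg_z : offset (j *: z) = - j *: offset z by case: (offset_imagZ ze).
have j_neq0 : j != 0.
  by apply: contra_eq_neq j_sqr => ->; rewrite mul0r eq_sym oppr_eq0 oner_eq0.
have opp_eq0 (v : H) : - j *: v = j *: v -> v = 0.
  move/eqP; rewrite scaleNr eq_sym -subr_eq0 opprK -mulr2n -scaler_nat scalerA.
  by rewrite scaler_eq0 mulf_eq0 pnatr_eq0 (negPf j_neq0) /= => /eqP.
right=> w we; case: (offset_imagZ we) => // pos_w.
have zwe : ip (z + w) e = 0 by rewrite ipDl ze we addr0.
have : offset (j *: (z + w)) = - j *: offset z + j *: offset w.
  by rewrite scalerDr offsetD ?orth_j // neg_z pos_w.
case: (offset_imagZ zwe) => ->; rewrite offsetD // scalerDr.
  by move/addIr/esym/opp_eq0 => z0; case: not_pos; rewrite neg_z z0 !scaler0.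
by move/addrI/opp_eq0 => w0; rewrite pos_w w0 !scaler0.
Qed.

Lemma offset_complexZ k p q z :
  (forall w, ip w e = 0 -> offset (j *: w) = k *: offset w) ->
  conj p = p -> conj q = q -> ip z e = 0 ->
  offset ((p + q * j) *: z) = (p + q * k) *: offset z.
Proof.
move=> jZ p_real q_real ze.
have qjz : ip (q *: (j *: z)) e = 0 by rewrite ipZl orth_j ?mulr0.
rewrite scalerDl -scalerA (offset_real_linear p_real ze qjz).
by rewrite (offset_realZ q_real (orth_j ze)) jZ // scalerDl scalerA.
Qed.

End ImaginaryUnit.

Lemma offset_semilinear : exists2 s, scalar_aut s &
  forall a z, ip z e = 0 -> offset (a *: z) = s a *: offset z.
Proof.
case: (real_or_complex cK) => [all_real|[j [j_sqr j_conj decomp]]].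
  by exists id => [|a z ze]; [left | rewrite offset_realZ].
case: (offset_imagZ_uniform j_sqr j_conj) => jZ.
  exists id => [|a z ze]; first by left.
  by have [p [q [p_real q_real ->]]] := decomp a; rewrite (offset_complexZ jZ).
exists conj => [|a z ze]; first by right.
have [p [q [p_real q_real ->]]] := decomp a.
by rewrite (offset_complexZ jZ) // (conjD cK) (conjM cK) p_real q_real j_conj.
Qed.

Section WignerLift.
Variable s : K -> K.
Hypothesis s_aut : scalar_aut s.
Hypothesis offsetZ : forall a z, ip z e = 0 -> offset (a *: z) = s a *: offset z.

Let resid (x : H) := x - ip x e *: e.

Let ip_resid x : ip (resid x) e = 0.
Proof. by rewrite ipBl ipZl e_unit mulr1 subrr. Qed.

Definition wigner_lift (x : H) := s (ip x e) *: T e + offset (resid x).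

Lemma wigner_lift_semilinear : semilinear s wigner_lift.
Proof.
split=> // a x y; rewrite /wigner_lift ipDl ipZl.
have -> : resid (a *: x + y) = a *: resid x + resid y.
  by rewrite /resid ipDl ipZl scalerBr scalerDl scalerA opprD addrACA.
rewrite (scalar_autD s_aut) (scalar_autM s_aut) offsetD ?ipZl ?ip_resid ?mulr0 //.
by rewrite offsetZ ?ip_resid // scalerDl [in RHS]scalerDr -scalerA addrACA.
Qed.

Lemma wigner_lift_isometry : semilinear_isometry s wigner_lift.
Proof.
split=> [|x]; first exact: wigner_lift_semilinear.
rewrite /wigner_lift (ip_sqr_unit_comb _ _ (ip_offset_base (ip_resid x))).
  by rewrite ip_offset_self // ip_unit_resid // (norm_scalar_aut s_aut) addrC subrK.
by rewrite /unit_vector wigner_ip_self.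
Qed.

Lemma wigner_lift_line x : exists c, wigner_lift x = c *: T x.
Proof.
rewrite /wigner_lift; have [xe0|xe_neq0] := eqVneq (ip x e) 0.
  have -> : resid x = x by rewrite /resid xe0 scale0r subr0.
  have [c _ ->] := offset_scale xe0; exists c.
  by rewrite xe0 (scalar_aut0 s_aut) scale0r add0r.
set a := ip x e in xe_neq0 *.
have orth_e : ip (a^-1 *: resid x) e = 0 by rewrite ipZl ip_resid mulr0.
have -> : s a *: T e + offset (resid x) = s a *: (T e + offset (a^-1 *: resid x)).
  rewrite scalerDr offsetZ ?ip_resid // scalerA -(scalar_autM s_aut) divff //.
  by rewrite (scalar_aut1 s_aut) scale1r.
have [c _ ->] := offset_line orth_e.
have -> : e + a^-1 *: resid x = a^-1 *: x.
  by rewrite /resid scalerBr scalerA mulVf // scale1r addrC subrK.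
by have [d ->] := wigner_scale a^-1 x; exists (s a * c * d); rewrite !scalerA.
Qed.

End WignerLift.
End Wigner.

Lemma exists_norm : exists norm : H -> K,
  (forall x, 0 <= norm x) /\ forall x, norm x ^+ 2 = ip x x.
Proof.
have /choice[norm normP] x : exists r : K, 0 <= r /\ r ^+ 2 = ip x x.
  by have [r r_ge0 r_sqr] := exists_sqrt cK (ip_ge0 x); exists r.
by exists norm; split=> x; have [] := normP x.
Qed.

Lemma exists_norm_ip_extension (chi : H -> H) :
  (forall x y, unit_vector x -> unit_vector y -> `|ip (chi x) (chi y)| = `|ip x y|) ->
  exists2 T : H -> H, forall x y, `|ip (T x) (T y)| = `|ip x y| &
    forall x, unit_vector x -> T x = chi x.
Proof.
move=> chi_norm_ip; have [norm [norm_ge0 norm_sqr]] := exists_norm.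
have norm_eq0 x : (norm x == 0) = (x == 0) by rewrite -sqrf_eq0 norm_sqr ip_eq0.
have conj_norm x : conj (norm x) = norm x by rewrite (conj_nneg cK).
have conj_normV x : conj (norm x)^-1 = (norm x)^-1 by rewrite (conj_nneg cK) ?invr_ge0.
exists (fun x => norm x *: chi ((norm x)^-1 *: x)) => [x y|x x_unit]; last first.
  suff -> : norm x = 1 by rewrite invr1 !scale1r.
  by apply/eqP; rewrite -(eqrXn2 (n := 2)) // norm_sqr x_unit expr1n.
have normalized z : z != 0 -> unit_vector ((norm z)^-1 *: z).
  move=> z_neq0; rewrite /unit_vector ipZl ipZr conj_normV -norm_sqr.
  by field; rewrite norm_eq0.
rewrite ipZl ipZr conj_norm.
have [->|x_neq0] := eqVneq x 0.
  by have /eqP -> : norm 0 == 0; rewrite ?norm_eq0 // mul0r ip0l.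
have [->|y_neq0] := eqVneq y 0.
  by have /eqP -> : norm 0 == 0; rewrite ?norm_eq0 // mul0r mulr0 ip0r.
rewrite !normrM (chi_norm_ip _ _ (normalized _ x_neq0) (normalized _ y_neq0)) -!normrM.
rewrite ipZl ipZr conj_normV.
by congr `|_|; field; rewrite !norm_eq0 y_neq0.
Qed.

Lemma wigner (chi : H -> H) :
  (forall x y, unit_vector x -> unit_vector y -> `|ip (chi x) (chi y)| = `|ip x y|) ->
  exists s V, semilinear_isometry s V /\
    forall x, unit_vector x -> exists c, V x = c *: chi x.
Proof.
move=> chi_norm_ip.
have [[e e_unit]|no_unit] := pselect (exists e, unit_vector e); last first.
  exists id, id; split; last by move=> x x_unit; case: no_unit; exists x.
  by split=> //; exact: is_linear_semilinear.
have [T T_norm_ip T_chi] := exists_norm_ip_extension chi_norm_ip.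
have [s s_aut offsetZ] := offset_semilinear T_norm_ip e_unit.
exists s, (wigner_lift T e s); split; first exact: wigner_lift_isometry.
by move=> x x_unit; rewrite -T_chi //; exact: wigner_lift_line.
Qed.

(** * Orthogonal projection onto complete subspaces *)

Definition subspace (S : H -> Prop) :=
  S 0 /\ forall (a : K) x y, S x -> S y -> S (a *: x + y).

Definition complete_subspace (S : H -> Prop) := subspace S /\
  forall u, (forall m, S (u m)) -> cauchy_seq ip u -> exists2 l, S l & converges_to ip u l.

Lemma subspaceZ S a x : subspace S -> S x -> S (a *: x).
Proof. by move=> [S0 linS] Sx; rewrite -[_ *: _]addr0; exact: linS. Qed.

Lemma subspaceD S x y : subspace S -> S x -> S y -> S (x + y).
Proof. by move=> [_ linS] Sx Sy; rewrite -[x]scale1r; exact: linS. Qed.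

Lemma sqr_normD_le (a b : K) : `|a + b| ^+ 2 <= 2 * `|a| ^+ 2 + 2 * `|b| ^+ 2.
Proof.
rewrite -(lerD2r (`|a - b| ^+ 2)) -!(mul_conj cK) !(conjD cK) conjN.
rewrite [X in X <= _](_ : _ = 2 * (a * conj a) + 2 * (b * conj b)); last by ring.
by rewrite lerDl -conjN -(conjD cK) (mul_conj cK) exprn_ge0.
Qed.

Lemma converges_to_ip_eq0 v l w : converges_to ip v l ->
  (forall eps, 0 < eps -> exists N, forall m, (N <= m)%N -> `|ip (v m) w| ^+ 2 < eps) ->
  ip l w = 0.
Proof.
move=> vl vw; have [->|w_neq0] := eqVneq w 0; first by rewrite ip0r.
have ww_gt0 : 0 < ip w w by rewrite ip_gt0.
apply/eqP; rewrite -normr_eq0 -sqrf_eq0 eq_le exprn_ge0 // andbT.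
apply/ler_addgt0Pr => eps eps_gt0; rewrite add0r.
have quarter_gt0 : 0 < eps / 4 by rewrite divr_gt0 ?ltr0n.
have [M ltM] := vl _ (divr_gt0 quarter_gt0 ww_gt0); have [N ltN] := vw _ quarter_gt0.
pose m := maxn M N; have -> : l = v m + - (v m - l) by rewrite opprB addrC subrK.
rewrite ipDl ipNl; apply: le_trans (sqr_normD_le _ _) _; rewrite normrN.
have -> : eps = 2 * (eps / 4) + 2 * (eps / 4) by field.
apply: lerD; rewrite ler_pM2l ?ltr0n //.
  by apply/ltW/ltN; exact: leq_maxr.
apply: le_trans (cauchy_schwarz _ _) _; rewrite -ler_pdivlMr //.
by apply/ltW/ltM; exact: leq_maxl.
Qed.

Section NearestPoint.
Variables (S : H -> Prop) (y : H) (d : K) (u : nat -> H).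
Hypothesis subS : subspace S.
Hypothesis dist_ge : forall t, S t -> d <= ip (y - t) (y - t).
Hypothesis Su : forall k, S (u k).
Hypothesis u_lt : forall k, ip (y - u k) (y - u k) < d + k.+1%:R^-1.

Lemma minimizing_seq_lt N k : (N <= k)%N -> ip (y - u k) (y - u k) < d + N.+1%:R^-1.
Proof.
move=> Nk; apply: lt_le_trans (u_lt k) _; rewrite lerD2l.
by rewrite lef_pV2 ?posrE ?ltr0Sn // ler_nat ltnS.
Qed.

Lemma minimizing_seq_cauchy : cauchy_seq ip u.
Proof.
move=> eps eps_gt0.
have [N ltN] : exists N, N.+1%:R^-1 < eps / 4.
  by apply: (exists_invS_lt cK); rewrite divr_gt0 ?ltr0n.
exists N => m k Nm Nk; rewrite (parallelogram (u m) (u k) y).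
have := dist_ge (subspaceZ 2^-1 subS (subspaceD subS (Su m) (Su k))).
move: (minimizing_seq_lt Nm) (minimizing_seq_lt Nk) ltN; move: (N.+1%:R^-1) => delta.
move: (ip _ _) (ip _ _) (ip _ _) => p q r p_lt q_lt delta_lt r_ge.
have -> : eps = 2 * (d + eps / 4) + 2 * (d + eps / 4) - 4 * d by field.
apply: ltr_leD; last by rewrite lerN2 ler_pM2l ?ltr0n.
apply: ltrD; rewrite ltr_pM2l ?ltr0n //; apply: lt_trans; try eassumption.
  by rewrite ltrD2l.
by rewrite ltrD2l.
Qed.

Lemma minimizing_seq_ip_lt w m : unit_vector w -> S w ->
  `|ip (y - u m) w| ^+ 2 < m.+1%:R^-1.
Proof.
move=> w_unit Sw; rewrite -(ltrD2l d); apply: le_lt_trans (u_lt m).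
rewrite -lerBrDr -ip_unit_resid //.
have -> : y - u m - ip (y - u m) w *: w = y - (ip (y - u m) w *: w + u m).
  by rewrite opprD addrA addrAC.
by apply: dist_ge; apply: subspaceD => //; exact: subspaceZ.
Qed.

Lemma minimizing_seq_limit_orth l z : converges_to ip u l -> S z -> ip (y - l) z = 0.
Proof.
move=> ul Sz; have [->|/exists_unit[a a_gt0 az_unit]] := eqVneq z 0.
  by rewrite ip0r.
suff : ip (y - l) (a *: z) = 0.
  by rewrite ipZr => /eqP; rewrite mulf_eq0 (conj_nneg cK (ltW a_gt0)) gt_eqF // => /eqP.
apply: (@converges_to_ip_eq0 (fun m => y - u m)) => eps eps_gt0.
  have [N ltN] := ul _ eps_gt0; exists N => m /ltN.
  have -> : y - u m - (y - l) = - (u m - l) by rewrite opprB addrC subrKA opprB.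
  by rewrite ipNl ipNr opprK.
have [N ltN] := exists_invS_lt cK eps_gt0; exists N => m Nm.
apply: lt_trans (minimizing_seq_ip_lt _ _ _) (le_lt_trans _ ltN) => //.
  exact: subspaceZ.
by rewrite lef_pV2 ?posrE ?ltr0Sn // ler_nat ltnS.
Qed.

End NearestPoint.

Lemma exists_orth_decomposition S y : complete_subspace S ->
  exists t, S t /\ forall z, S z -> ip (y - t) z = 0.
Proof.
move=> [subS completeS].
have [||d [_ d_lb d_approx]] :=
    exists_inf cK (A := fun a => exists2 t, S t & a = ip (y - t) (y - t)).
- by exists (ip (y - 0) (y - 0)), 0 => //; case: subS.
- by move=> a [t _ ->]; exact: ip_ge0.
have dist_ge t : S t -> d <= ip (y - t) (y - t) by move=> St; apply: d_lb; exists t.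
have /choice[u uP] k : exists t, S t /\ ip (y - t) (y - t) < d + k.+1%:R^-1.
  have invS_gt0 : 0 < k.+1%:R^-1 :> K by rewrite invr_gt0 ltr0Sn.
  by have [_ [t St ->] lt] := d_approx _ invS_gt0; exists t.
have Su k := (uP k).1; have u_lt k := (uP k).2.
have [l Sl ul] := completeS u Su (minimizing_seq_cauchy subS dist_ge Su u_lt).
by exists l; split=> // z; exact: (minimizing_seq_limit_orth subS dist_ge Su u_lt ul).
Qed.

Lemma exists_projection_onto S : complete_subspace S ->
  exists2 P, is_projection ip P & forall x, S x <-> P x = x.
Proof.
move=> compS; have [[_ linS] _] := compS.
have /choice[P PP] y := exists_orth_decomposition y compS.
have SP x : S (P x) := (PP x).1.
have P_ip x y : ip (P x) y = ip (P x) (P y).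
  by apply/eqP; rewrite -subr_eq0 -ipBr; apply/eqP/ip_sym0; exact: (PP y).2.
have adjP : is_adjoint ip P P by move=> x y; rewrite P_ip (ipC (P y) x) (P_ip y x) -ipC.
have P_fix x : S x -> P x = x.
  move=> Sx; apply/esym/eqP; rewrite -subr_eq0 -ip_eq0; apply/eqP; apply: (PP x).2.
  by rewrite addrC -scaleN1r; exact: linS (SP x) Sx.
exists P => [|x]; last by split=> [/P_fix|<-].
apply: projection_of_idempotent => // [a x y|x]; last exact: P_fix.
by apply: ip_injl => z; rewrite adjP !(ipDl, ipZl) !adjP.
Qed.

Lemma projection_eq0 P y : is_projection ip P ->
  (forall z, P z = z -> ip y z = 0) -> P y = 0.
Proof.
move=> projP orth_y; apply/eqP; rewrite -ip_eq0 (projection_ip projP); apply/eqP.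
by apply/ip_sym0/orth_y; rewrite (projection_idem projP).
Qed.

Hypothesis ip_complete : is_complete ip.

Definition adjoint_pair (s : K -> K) (V Vs : H -> H) :=
  forall x y, ip (V x) y = s (ip x (Vs y)).

Lemma range_isometry_complete s V : semilinear_isometry s V -> complete_subspace (range V).
Proof.
move=> isoV; have linV := isometry_semilinear isoV; have normV := isometry_norm isoV.
split; first split.
- by exists 0; rewrite (semilinear0 linV).
- move=> a _ _ [x ->] [y ->]; exists (s a *: x + y).
  by rewrite (semilinearP linV) (scalar_autK (semilinear_aut linV)).
move=> u /choice[x ux] u_cauchy.
have [|l xl] := ip_complete (u := x).
  move=> eps /u_cauchy[N lt]; exists N => m k Nm Nk; have := lt m k Nm Nk.
  by rewrite !ux -(semilinearB linV) normV.
exists (V l); first by exists l.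
move=> eps /xl[N lt]; exists N => m Nm.
by rewrite ux -(semilinearB linV) normV; exact: lt.
Qed.

Lemma exists_adjoint s V : semilinear_isometry s V -> exists Vs, adjoint_pair s V Vs.
Proof.
move=> isoV.
have [P projP rangeP] := exists_projection_onto (range_isometry_complete isoV).
suff /choice[Vs VsP] y : exists t, forall x, ip (V x) y = s (ip x t) by exists Vs.
have /(rangeP (P y))[t Py] := projection_idem projP y; exists t => x.
have /rangeP VxP : range V (V x) by exists x.
by rewrite -(semilinear_isometry_ip isoV) -Py -(projection_adj projP) VxP.
Qed.

Lemma exists_span_projection (A : H -> Prop) : exists T, [/\ is_projection ip T,
  forall a, A a -> T a = a & forall y, (forall a, A a -> ip y a = 0) -> T y = 0].
Proof.
pose S x := forall y, (forall a, A a -> ip y a = 0) -> ip x y = 0.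
have compS : complete_subspace S.
  split; first split.
  - by move=> y _; rewrite ip0l.
  - by move=> a x y Sx Sy z Az; rewrite ipDl ipZl Sx // Sy // mulr0 addr0.
  move=> u Su /ip_complete[l ul]; exists l => // y Ay.
  apply: (converges_to_ip_eq0 ul) => eps eps_gt0; exists 0%N => m _.
  by rewrite Su // normr0 expr0n.
have [T projT rangeT] := exists_projection_onto compS; exists T; split=> //.
- by move=> a Aa; apply/rangeT => y Ay; exact/ip_sym0/Ay.
- by move=> y Ay; apply: projection_eq0 => // z /rangeT Sz; exact/ip_sym0/Sz.
Qed.

Lemma adjoint_pair_cases s V Vs : scalar_aut s -> semilinear s V -> adjoint_pair s V Vs ->
  (is_linear V /\ is_adjoint ip V Vs) \/
  (is_conj_linear conj V /\ is_conj_adjoint conj ip V Vs).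
Proof. by move=> [] -> [_ linV] adjV; [left | right]. Qed.

(** * The theorem in finite rank *)

Lemma proj_rank_uniq n P Q : n = 0%N \/ ~ dim_ge H n.+1 ->
  proj_rank ip n P -> proj_rank ip n Q -> P = Q.
Proof.
case=> [-> | ndim] rP rQ; last by apply/funext => x; rewrite !(proj_rank_full _ ndim).
have [f _ ->] := proj_rank_basis rP; have [g _ ->] := proj_rank_basis rQ.
by apply/funext => x; rewrite /coord_proj !big1 // => -[].
Qed.

Lemma finite_rank_implemented n phi s V Vs :
  semilinear_isometry s V -> adjoint_pair s V Vs ->
  (forall P, proj_rank ip n P -> proj_rank ip n (phi P)) ->
  (forall P x, proj_rank ip n P -> unit_vector x -> P x = x -> phi P (V x) = V x) ->
  forall P, proj_rank ip n P -> phi P = V \o P \o Vs.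
Proof.
move=> isoV adjV phi_rank phi_fix P rP; have linV := isometry_semilinear isoV.
have [f of_ eP] := proj_rank_basis rP.
rewrite (proj_rank_eq (phi_rank P rP) (orthonormal_isometry isoV of_)) => [|i]; last first.
  apply: phi_fix rP (orthonormal_unit i of_) _.
  by rewrite eP coord_proj_basis // inE scale1r.
apply/funext => x; rewrite eP /= /coord_proj (semilinear_sum linV).
apply: eq_bigr => i _; rewrite (semilinearZ linV) ipC adjV.
by rewrite -(scalar_aut_conj (semilinear_aut linV)) -ipC.
Qed.

Theorem finite_rank_wigner n (phi : (H -> H) -> (H -> H)) :
  (forall P, proj_rank ip n P -> proj_rank ip n (phi P)) ->
  (forall P Q, proj_rank ip n P -> proj_rank ip n Q -> angle_eq ip (phi P) (phi Q) P Q) ->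
  n = 1%N \/ ~ has_dim H (n + n) ->
  exists s V Vs, [/\ semilinear_isometry s V, adjoint_pair s V Vs &
    forall P, proj_rank ip n P -> phi P = V \o P \o Vs].
Proof.
move=> phi_rank phi_angle dimH.
have [trivial|] := pselect (n = 0%N \/ ~ dim_ge H n.+1).
  exists id, id, id; split=> //; last first.
    by move=> P rP; exact: proj_rank_uniq trivial (phi_rank _ rP) rP.
  by split=> //; exact: is_linear_semilinear.
case/not_orP => /eqP; rewrite -lt0n => n_gt0 /contrapT dim_gt.
have dim_neq : n = 1%N \/ (dim_ge H (n + n).+1 \/ ~ dim_ge H (n + n)).
  case: dimH => [->|ndim]; [by left | right].
  have [|dim_le] := pselect (dim_ge H (n + n).+1); first by left.
  by right=> dim_ge2n; apply: ndim; exact: has_dim_of_dim_ge.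
have [chi [chi_norm_ip chi_fix]] :=
  exists_finite_line_map n_gt0 phi_rank phi_angle dim_neq dim_gt.
have [s [V [isoV V_chi]]] := wigner chi_norm_ip; have [Vs adjV] := exists_adjoint isoV.
exists s, V, Vs; split=> //; apply: (finite_rank_implemented isoV adjV phi_rank).
move=> P x rP x_unit Px; have [projP' _] := phi_rank P rP.
by have [c ->] := V_chi x x_unit; rewrite (projectionZ projP') chi_fix.
Qed.

(** * Order and lines on projections of infinite rank *)

Definition infinite_rank (P : H -> H) :=
  is_projection ip P /\ forall l, has_unit_orth (fun u => P u = u) l.

Definition le_proj (M P : H -> H) := forall x, P (M x) = M x.

Definition compl_proj (P : H -> H) (x : H) := x - P x.

Definition biinfinite (P : H -> H) := infinite_rank P /\ infinite_rank (compl_proj P).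

Coercion infinite_rank_projection P (iP : infinite_rank P) : is_projection ip P := iP.1.

Coercion biinfinite_rank P (bP : biinfinite P) : infinite_rank P := bP.1.

Lemma proj_inf_rankP P : proj_inf_rank ip P <-> infinite_rank P.
Proof.
split=> -[projP inf]; split=> //.
  move=> l; have [v [rv iv]] := inf (size l).+1.
  by apply: (lin_indep_has_unit_orth projP iv) => // i; exact/(range_projection projP).
move=> m.
have [f [of_ Pf _]] := exists_orthonormal (fun l _ => inf l) (leqnn (size [::] + m)).
exists f; split; last exact: orthonormal_lin_indep.
by move=> i; exact/(range_projection projP).
Qed.

Lemma infinite_rank_id : inf_dim H -> infinite_rank id.
Proof.
move=> infH; split=> [|l]; first exact: projection_id.
have [u [_ u_unit ul]] := dim_ge_has_unit_orth (infH _) (ltnSn (size l)).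
by exists u.
Qed.

Lemma le_proj_absorb M P : is_projection ip M -> is_projection ip P -> le_proj M P ->
  forall x, M (P x) = M x.
Proof.
move=> /projection_adj adjM /projection_adj adjP.
exact: (self_adjoint_comp adjP adjM adjM).
Qed.

Lemma le_proj_of_absorb M P : is_projection ip M -> is_projection ip P ->
  (forall x, M (P x) = M x) -> le_proj M P.
Proof.
move=> /projection_adj adjM /projection_adj adjP.
exact: (self_adjoint_comp adjM adjP adjM).
Qed.

Lemma le_proj_refl P : is_projection ip P -> le_proj P P.
Proof. exact: projection_idem. Qed.

Lemma le_proj_trans P M Q : le_proj M P -> le_proj P Q -> le_proj M Q.
Proof. by move=> MP PQ x; rewrite -MP PQ. Qed.

Lemma le_proj_anti P Q : is_projection ip P -> is_projection ip Q ->
  le_proj P Q -> le_proj Q P -> P = Q.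
Proof. by move=> projP projQ PQ QP; apply: projection_eq. Qed.

Lemma le_proj_eq0 M P x : is_projection ip M -> is_projection ip P ->
  le_proj M P -> P x = 0 -> M x = 0.
Proof.
by move=> projM projP MP Px; rewrite -(le_proj_absorb projM projP MP) Px projection0.
Qed.

Lemma infinite_rank_le P Q : is_projection ip Q -> infinite_rank P -> le_proj P Q ->
  infinite_rank Q.
Proof.
move=> projQ [_ inf] PQ; split=> // l; have [u [Pu u_unit ul]] := inf l.
by exists u; split=> //; rewrite -Pu PQ.
Qed.

Lemma compl_proj_projection P : is_projection ip P -> is_projection ip (compl_proj P).
Proof.
move=> projP; apply: projection_of_idempotent => [a x y|x|x y]; rewrite /compl_proj.
- by rewrite (semilinearP (projection_linear projP)) scalerBr opprD addrACA.
- by rewrite (projectionB projP) (projection_idem projP) subrr subr0.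
- by rewrite ipBl ipBr (projection_adj projP).
Qed.

Lemma compl_projK P : compl_proj (compl_proj P) = P.
Proof. by apply/funext => x; rewrite /compl_proj subKr. Qed.

Lemma proj_compl_eq0 P x : is_projection ip P -> P (compl_proj P x) = 0.
Proof. by move=> projP; rewrite (projectionB projP) (projection_idem projP) subrr. Qed.

Lemma proj_compl_decomp P x : x = P x + compl_proj P x.
Proof. by rewrite addrC subrK. Qed.

Lemma orth_sym P Q : is_projection ip P -> is_projection ip Q -> orth P Q -> orth Q P.
Proof.
move=> /projection_adj adjP /projection_adj adjQ.
by apply: self_adjoint_comp => // x y; rewrite ip0l ip0r.
Qed.

Lemma orth_compl P : is_projection ip P -> orth (compl_proj P) P.
Proof. by move=> projP x; rewrite /compl_proj (projection_idem projP) subrr. Qed.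

Lemma orth_compl_le M P : orth (compl_proj P) M <-> le_proj M P.
Proof.
split=> MP x; last by rewrite /compl_proj MP subrr.
by have /eqP := MP x; rewrite subr_eq0 => /eqP.
Qed.

Lemma orth_le_compl P R : is_projection ip P -> is_projection ip R -> orth R P ->
  le_proj R (compl_proj P).
Proof.
by move=> projP projR RP x; rewrite /compl_proj (orth_sym projR projP RP) subr0.
Qed.

Lemma exists_between M P : is_projection ip M -> is_projection ip P -> le_proj M P ->
  ~ le_proj P M -> exists x, [/\ unit_vector x, P x = x & M x = 0].
Proof.
move=> projM projP MP /existsNP[y /eqP]; rewrite eq_sym -subr_eq0.
move=> /exists_unit[a _ u_unit]; exists (a *: (P y - M (P y))); split=> //.
  by rewrite (projectionZ projP) (projectionB projP) (projection_idem projP) MP.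
by rewrite (projectionZ projM) (projectionB projM) (projection_idem projM) subrr scaler0.
Qed.

Lemma biinfinite_compl P : biinfinite P -> biinfinite (compl_proj P).
Proof. by case=> iP iC; split; rewrite ?compl_projK. Qed.

Definition add_line (M : H -> H) (u x : H) := M x + ip x u *: u.

Lemma add_line_self M u : unit_vector u -> M u = 0 -> add_line M u u = u.
Proof. by move=> u_unit Mu; rewrite /add_line Mu u_unit scale1r add0r. Qed.

Lemma add_line_projection M u : is_projection ip M -> unit_vector u -> M u = 0 ->
  is_projection ip (add_line M u).
Proof.
move=> projM u_unit Mu; apply: projection_of_idempotent => [a x y|x|x y]; rewrite /add_line.
- rewrite (semilinearP (projection_linear projM)) ipDl ipZl scalerDl scalerDr scalerA.
  by rewrite addrACA.
- rewrite (projectionD projM) (projectionZ projM) (projection_idem projM) Mu scaler0.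
  rewrite addr0; congr (_ + _ *: _).
  by rewrite ipDl ipZl u_unit mulr1 (projection_adj projM) Mu ip0r add0r.
- rewrite !(ipDl, ipDr, ipZl, ipZr) (projection_adj projM); congr (_ + _).
  by rewrite -ipC mulrC.
Qed.

Lemma le_add_line M u : is_projection ip M -> M u = 0 -> le_proj M (add_line M u).
Proof.
move=> projM Mu x; rewrite /add_line (projection_idem projM) (projection_adj projM) Mu.
by rewrite ip0r scale0r addr0.
Qed.

Lemma add_line_le M u P : is_projection ip P -> le_proj M P -> P u = u ->
  le_proj (add_line M u) P.
Proof.
by move=> projP MP Pu x; rewrite /add_line (projectionD projP) (projectionZ projP) MP Pu.
Qed.

Lemma add_line_nle M u P : unit_vector u -> M u = 0 -> P u = 0 ->
  ~ le_proj (add_line M u) P.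
Proof.
move=> u_unit Mu Pu /(_ u); rewrite add_line_self // Pu => /esym/eqP.
by rewrite (negPf (unit_vector_neq0 u_unit)).
Qed.

Lemma add_line_eq M x y : unit_vector x -> unit_vector y -> M x = 0 ->
  add_line M x = add_line M y <-> `|ip x y| ^+ 2 = 1.
Proof.
move=> x_unit y_unit Mx; split=> [line_eq|norm1].
  have x_eq : ip x y *: y = x.
    by rewrite -[RHS](add_line_self x_unit Mx) line_eq /add_line Mx add0r.
  by rewrite sqr_norm_ip -[RHS]x_unit -{3}x_eq ipZl.
apply/funext => z; rewrite /add_line; congr (_ + _).
have -> : x = ip x y *: y by apply: cauchy_schwarz_unit_eq; rewrite ?norm1.
by rewrite ipZr scalerA mulrAC [conj _ * _]mulrC (mul_conj cK) norm1 mul1r.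
Qed.

Lemma add_line_between M x A : is_projection ip M -> is_projection ip A ->
  unit_vector x -> M x = 0 -> le_proj M A -> le_proj A (add_line M x) ->
  A = M \/ A = add_line M x.
Proof.
move=> projM projA x_unit Mx MA AP; have projP := add_line_projection projM x_unit Mx.
have A_x : A x = ip (A x) x *: x.
  by rewrite -{1}(AP x) /add_line (le_proj_absorb projM projA MA) Mx add0r.
have AE y : A y = M y + ip y x *: A x.
  rewrite -(le_proj_absorb projA projP AP) /add_line (projectionD projA) MA.
  by rewrite (projectionZ projA).
have [Ax0|Ax] :=
  idempotent_eigenvector (projection_linear projA) (projection_idem projA) A_x.
  by left; apply/funext => y; rewrite AE Ax0 scaler0 addr0.
by right; apply/funext => y; rewrite AE Ax.
Qed.

Lemma biinfinite_add_line M u : biinfinite M -> unit_vector u -> M u = 0 ->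
  biinfinite (add_line M u).
Proof.
move=> bM u_unit Mu; have projP := add_line_projection bM u_unit Mu; split.
  exact: infinite_rank_le projP bM (le_add_line bM Mu).
split=> [|l]; first exact: compl_proj_projection projP.
have [v [Cv v_unit vl]] := bM.2.2 (u :: l); exists v; split=> //.
  by rewrite /compl_proj /add_line (vl u) ?mem_head // scale0r addr0; exact: Cv.
by move=> y yl; apply: vl; rewrite inE yl orbT.
Qed.

Definition sub_line (P : H -> H) (u : H) := compl_proj (add_line (compl_proj P) u).

Lemma sub_lineE P u x : sub_line P u x = P x - ip x u *: u.
Proof. by rewrite /sub_line /add_line /compl_proj opprD addrA subKr. Qed.

Lemma sub_lineK P u : add_line (sub_line P u) u = P.
Proof. by apply/funext => x; rewrite /add_line sub_lineE subrK. Qed.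

Lemma sub_line_self P u : unit_vector u -> P u = u -> sub_line P u u = 0.
Proof. by move=> u_unit Pu; rewrite sub_lineE Pu u_unit scale1r subrr. Qed.

Lemma biinfinite_sub_line P u : biinfinite P -> unit_vector u -> P u = u ->
  biinfinite (sub_line P u).
Proof.
move=> /biinfinite_compl bC u_unit Pu; apply/biinfinite_compl/biinfinite_add_line => //.
by rewrite /compl_proj Pu subrr.
Qed.

Lemma infinite_rank_seq P (m : nat -> H) : is_projection ip P -> orthonormal m ->
  (forall k, P (m k) = m k) -> infinite_rank P.
Proof.
move=> projP om Pm; split=> // l.
have om_l : orthonormal (fun i : 'I_(size l).+1 => m i).
  exact: orthonormal_comp val_inj om.
by apply: (lin_indep_has_unit_orth projP (orthonormal_lin_indep om_l)).
Qed.

(* The closed span of the [m k] whose index [k] has a residue modulo [p] in [B]. *)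
Lemma exists_residue_projection p (B : pred nat) (m : nat -> H) : orthonormal m ->
  (exists2 r, (r < p)%N & B r) -> (exists2 r, (r < p)%N & ~~ B r) ->
  exists T, [/\ biinfinite T, forall k, B (k %% p)%N -> T (m k) = m k,
    forall P, is_projection ip P -> (forall k, B (k %% p)%N -> P (m k) = m k) ->
      le_proj T P &
    forall y, (forall k, ip y (m k) = 0) -> T y = 0].
Proof.
move=> om [r rp Br] [r' rp' nBr'].
have [T [projT T_fix T_eq0]] :=
  exists_span_projection (fun a => exists2 k, B (k %% p)%N & a = m k).
have Tm k : B (k %% p)%N -> T (m k) = m k by move=> Bk; apply: T_fix; exists k.
have residue i : (i < p)%N -> forall k, ((k * p + i) %% p = i)%N.
  by move=> i_lt k; rewrite modnMDl modn_small.
have residue_inj i : (i < p)%N -> injective (fun k => k * p + i)%N.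
  by move=> i_lt k l /addIn/eqP; rewrite eqn_pmul2r ?(leq_trans _ i_lt) // => /eqP.
exists T; split=> //.
- split.
    apply: infinite_rank_seq (orthonormal_comp (residue_inj r rp) om) _ => // k.
    by apply: Tm; rewrite residue.
  apply: infinite_rank_seq (orthonormal_comp (residue_inj r' rp') om) _.
    exact: compl_proj_projection projT.
  move=> k; rewrite /compl_proj /= T_eq0 ?subr0 // => _ [l Bl ->]; rewrite om.
  by case: eqP => // kl; move: Bl nBr'; rewrite -kl residue // => ->.
- move=> P projP Pm; apply: le_proj_of_absorb => // x; apply/esym/eqP.
  rewrite -subr_eq0 -(projectionB projT); apply/eqP/T_eq0 => _ [k /Pm Pmk ->].
  by rewrite ipBl (projection_adj projP) Pmk subrr.
- by move=> y ym; apply: T_eq0 => _ [k _ ->].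
Qed.

Lemma exists_biinfinite_le P (l : seq H) : infinite_rank P ->
  exists T, [/\ biinfinite T, le_proj T P & forall y, y \in l -> T y = 0].
Proof.
move=> [projP inf].
have [|m om mP] := @exists_orthonormal_seq (fun _ u => P u = u /\ orth_to u l).
  move=> _ l'; have [u [Pu u_unit ul]] := inf (l ++ l'); exists u; split=> //.
    by split=> // y yl; apply: ul; rewrite mem_cat yl.
  by move=> y yl; apply: ul; rewrite mem_cat yl orbT.
have [||T [bT _ TP T_eq0]] := exists_residue_projection (p := 2) (B := pred1 0%N) om.
- by exists 0%N.
- by exists 1%N.
exists T; split=> //; first by apply: TP => // k _; have [] := mP k.
by move=> y yl; apply: T_eq0 => k; apply/ip_sym0/(mP k).2.
Qed.

(* The residue [2] modulo [3] is left out of [S], which keeps its corank infinite. *)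
Lemma exists_biinfinite_bound M N : infinite_rank M -> infinite_rank N ->
  exists M' N' S, [/\ [/\ biinfinite M', le_proj M' M & le_proj M' S],
    [/\ biinfinite N', le_proj N' N & le_proj N' S], biinfinite S &
    forall x, M x = 0 -> N x = 0 -> S x = 0].
Proof.
move=> [projM infM] [projN infN].
pose side k := if (k %% 3 == 1)%N then N else M.
have [|m om m_side] := @exists_orthonormal_seq (fun k w => side k w = w).
  by move=> k l; rewrite /side; case: ifP.
have [||S [bS Sm _ S_eq0]] := exists_residue_projection (p := 3) (B := gtn 2) om.
- by exists 0%N.
- by exists 2%N.
have [||M' [bM' _ M'_le _]] := exists_residue_projection (p := 3) (B := pred1 0%N) om.
- by exists 0%N.
- by exists 1%N.
have [||N' [bN' _ N'_le _]] := exists_residue_projection (p := 3) (B := pred1 1%N) om.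
- by exists 1%N.
- by exists 0%N.
exists M', N', S; split=> //.
- split=> //; [apply: (M'_le M projM) | apply: (M'_le S bS)] => k /eqP k_mod;
    last by apply: Sm; rewrite k_mod.
  by have := m_side k; rewrite /side k_mod.
- split=> //; [apply: (N'_le N projN) | apply: (N'_le S bS)] => k /eqP k_mod;
    last by apply: Sm; rewrite k_mod.
  by have := m_side k; rewrite /side k_mod.
move=> x Mx Nx; apply: S_eq0 => k; apply: ip_sym0.
move: (m_side k); rewrite /side; case: ifP => _ mk.
  exact: projection_orth projN _ _ mk Nx.
exact: projection_orth projM _ _ mk Mx.
Qed.

(** * Commutants of infinite rank projections *)

Section Commutant.
Variables P D : H -> H.
Hypothesis iP : infinite_rank P.
Hypothesis linD : semilinear id D.
Hypothesis idemD : forall x, D (D x) = D x.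
Hypothesis commD : forall R, biinfinite R -> commuting R P -> commuting R D.

Lemma commutant_unit_eigenvector u : unit_vector u -> P u = u \/ P u = 0 ->
  D u = 0 \/ D u = u.
Proof.
move=> u_unit Pu; apply: (idempotent_eigenvector (c := ip (D u) u) linD idemD).
(* [T] and [add_line T u] commute with [D], hence so does their difference, the
   projection onto the line of [u]. *)
have [T [bT TP /(_ u (mem_head _ _)) Tu]] := exists_biinfinite_le [:: u] iP.
have commT : commuting T P by move=> z; rewrite TP (le_proj_absorb bT iP TP).
have comm_line : commuting (add_line T u) P.
  move=> z; rewrite /add_line (projectionD iP) (projectionZ iP) commT.
  congr (_ + _); rewrite (projection_adj iP).
  by case: Pu => ->; rewrite ?ip0r ?scale0r ?scaler0.
have := commD (biinfinite_add_line bT u_unit Tu) comm_line u.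
by rewrite add_line_self // /add_line (commD bT commT) Tu (semilinear0 linD) add0r.
Qed.

Lemma commutant_eigenvector x : P x = x \/ P x = 0 -> D x = 0 \/ D x = x.
Proof.
move=> Px; have [->|/exists_unit[a a_gt0 ax_unit]] := eqVneq x 0.
  by left; rewrite (semilinear0 linD).
have a_neq0 : a != 0 by rewrite gt_eqF.
have [|Dax|Dax] := commutant_unit_eigenvector ax_unit.
- by rewrite (projectionZ iP); case: Px => ->; [left | right; rewrite scaler0].
- by left; apply: (scalerI a_neq0); rewrite -(semilinearZ linD) Dax scaler0.
- by right; apply: (scalerI a_neq0); rewrite -(semilinearZ linD) Dax.
Qed.

Lemma commutant_uniform Q : semilinear id Q ->
  (forall x, Q x = x -> P x = x \/ P x = 0) ->
  (forall x, Q x = x -> D x = 0) \/ (forall x, Q x = x -> D x = x).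
Proof.
move=> linQ QP; have [|/existsNP[x /not_implyP[Qx Dx]]] :=
  pselect (forall x, Q x = x -> D x = x); first by right.
have Dx0 : D x = 0 by case: (commutant_eigenvector (QP _ Qx)).
left=> y Qy; case: (commutant_eigenvector (QP _ Qy)) => // Dy.
have Dxy : D (x + y) = y by rewrite (semilinearD linD) Dx0 Dy add0r.
have Qxy : Q (x + y) = x + y by rewrite (semilinearD linQ) Qx Qy.
have [|] := commutant_eigenvector (QP _ Qxy); rewrite Dxy.
  by move=> ->; rewrite (semilinear0 linD).
rewrite -[LHS]add0r => /addIr x0; case: Dx.
by rewrite -x0 (semilinear0 linD).
Qed.

Lemma commutant_on_range : (forall x, D (P x) = 0) \/ (forall x, D (P x) = P x).
Proof.
have [DP|DP] := commutant_uniform (projection_linear iP) (fun x Px => or_introl Px).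
  by left=> x; apply: DP; rewrite (projection_idem iP).
by right=> x; apply: DP; rewrite (projection_idem iP).
Qed.

Lemma commutant_on_kernel :
  (forall x, D (compl_proj P x) = 0) \/ (forall x, D (compl_proj P x) = compl_proj P x).
Proof.
have projC := compl_proj_projection iP.
have [|DC|DC] := commutant_uniform (projection_linear projC).
- by move=> x <-; right; exact: proj_compl_eq0 iP.
- by left=> x; apply: DC; rewrite (projection_idem projC).
- by right=> x; apply: DC; rewrite (projection_idem projC).
Qed.

End Commutant.

(** * Angle-preserving surjections in infinite rank *)

Lemma add_line_QPQ M x y : is_projection ip M -> unit_vector y ->
  M x = 0 -> M y = 0 ->
  add_line M y (add_line M x (add_line M y y)) = `|ip x y| ^+ 2 *: y.
Proof.
move=> projM y_unit Mx My; rewrite add_line_self // {2}/add_line My add0r.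
rewrite /add_line (projectionZ projM) Mx scaler0 add0r ipZl.
by rewrite sqr_norm_ip mulrC.
Qed.

Lemma add_line_eigenvalue M x y v t : is_projection ip M ->
  unit_vector x -> unit_vector y -> M x = 0 -> M y = 0 -> v != 0 ->
  add_line M y (add_line M x (add_line M y v)) = t *: v ->
  [\/ t = 0, t = 1 | t = `|ip x y| ^+ 2].
Proof.
move=> projM x_unit y_unit Mx My v_neq0 eigen_v.
have projQ := add_line_projection projM y_unit My.
have projP := add_line_projection projM x_unit Mx.
have MQ := le_proj_absorb projM projQ (le_add_line projM My).
have MP := le_proj_absorb projM projP (le_add_line projM Mx).
have /eqP : M v = t *: M v by rewrite -(projectionZ projM) -eigen_v MQ MP MQ.
rewrite -subr_eq0 -{1}[M v]scale1r -scalerBl scaler_eq0 subr_eq0 eq_sym.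
have [->|_ /= /eqP Mv] := eqVneq t 1; first by move=> _; apply: Or32.
have /eqP : `|ip x y| ^+ 2 * ip v y = t * ip v y.
  rewrite -ipZl -eigen_v !(projection_adj projQ) (projection_adj projP).
  rewrite (projection_adj projQ) add_line_QPQ // ipZr (conj_nneg cK) //.
  by rewrite exprn_ge0.
rewrite -subr_eq0 -mulrBl mulf_eq0 subr_eq0 eq_sym.
have [->|_ /= /eqP vy] := eqVneq t (`|ip x y| ^+ 2); first by move=> _; apply: Or33.
apply: Or31; move: eigen_v; rewrite {3}/add_line Mv vy scale0r addr0.
rewrite (projection0 projP) (projection0 projQ) => /esym/eqP.
by rewrite scaler_eq0 (negPf v_neq0) orbF => /eqP.
Qed.

Definition unit_pair_in_kernel (M : H -> H) (x y : H) :=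
  [/\ unit_vector x, unit_vector y, M x = 0 & M y = 0].

Lemma add_line_angle_eq M x y M' u v : is_projection ip M -> is_projection ip M' ->
  unit_pair_in_kernel M x y -> unit_pair_in_kernel M' u v ->
  angle_eq ip (add_line M' u) (add_line M' v) (add_line M x) (add_line M y) ->
  [\/ `|ip u v| ^+ 2 = 0, `|ip u v| ^+ 2 = 1 | `|ip u v| ^+ 2 = `|ip x y| ^+ 2].
Proof.
move=> projM projM' [x_unit y_unit Mx My] [_ v_unit M'u M'v] [W [uW WT]].
apply: (add_line_eigenvalue projM x_unit y_unit Mx My (v := W v)).
  by rewrite -ip_eq0 (unitary_ip uW) v_unit oner_neq0.
have := WT v; rewrite /= add_line_QPQ // => <-.
exact: semilinearZ (unitary_linear uW) _ _.
Qed.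

Definition parallel (u v : H) := exists2 c, c != 0 & u = c *: v.

Lemma parallel_sym u v : parallel u v -> parallel v u.
Proof.
move=> [c c_neq0 ->]; exists c^-1; first by rewrite invr_eq0.
by rewrite scalerA mulVf // scale1r.
Qed.

Lemma parallel_trans v u w : parallel u v -> parallel v w -> parallel u w.
Proof.
by move=> [c c_neq0 ->] [d d_neq0 ->]; exists (c * d); rewrite ?mulf_neq0 // scalerA.
Qed.

Lemma parallel_neq0 c u v : u != 0 -> u = c *: v -> parallel u v.
Proof.
move=> u_neq0 u_eq; exists c => //; apply: contraNneq u_neq0 => c0.
by rewrite u_eq c0 scale0r.
Qed.

Lemma parallel_unit u v : unit_vector u -> unit_vector v -> parallel u v ->
  `|ip u v| ^+ 2 = 1.
Proof.
rewrite /unit_vector => u_unit v_unit [c _ u_eq]; move: u_unit.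
by rewrite u_eq !(ipZl, ipZr) v_unit !mulr1 (mul_conj cK).
Qed.

Section InfiniteRank.
Variable phi : (H -> H) -> (H -> H).
Hypothesis phi_infinite : forall P, infinite_rank P -> infinite_rank (phi P).
Hypothesis phi_surj : forall Q, infinite_rank Q -> exists2 P, infinite_rank P & phi P = Q.
Hypothesis phi_angle : forall P Q, infinite_rank P -> infinite_rank Q ->
  angle_eq ip (phi P) (phi Q) P Q.
Hypothesis infinite_dim : infinite_rank id.

Lemma phi_orth P Q : infinite_rank P -> infinite_rank Q ->
  orth P Q <-> orth (phi P) (phi Q).
Proof.
move=> iP iQ; have [iP' iQ'] := (phi_infinite iP, phi_infinite iQ); split.
  exact: (angle_eq_orth iQ iP' iQ' (phi_angle iP iQ)).
exact: (angle_eq_orth iQ' iP iQ (angle_eq_sym (phi_angle iP iQ))).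
Qed.

Lemma phi_commuting P Q : infinite_rank P -> infinite_rank Q ->
  commuting P Q -> commuting (phi P) (phi Q).
Proof.
move=> iP iQ.
exact: (angle_eq_commuting iP iQ (phi_infinite iP) (phi_infinite iQ) (phi_angle iP iQ)).
Qed.

Lemma phi_biinfinite P : biinfinite P -> biinfinite (phi P).
Proof.
move=> bP; have iP' := phi_infinite bP; have iC' := phi_infinite bP.2; split=> //.
apply: (infinite_rank_le (compl_proj_projection iP') iC').
by apply: (orth_le_compl iP' iC'); apply/(phi_orth bP.2 bP); exact: orth_compl bP.
Qed.

Lemma phi_biinfinite_inv P : infinite_rank P -> biinfinite (phi P) -> biinfinite P.
Proof.
move=> iP bP'; split=> //; have [R iR phiR] := phi_surj bP'.2.
apply: (infinite_rank_le (compl_proj_projection iP) iR).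
apply: (orth_le_compl iP iR); apply/(phi_orth iR iP); rewrite phiR.
exact: orth_compl bP'.
Qed.

Lemma exists_biinfinite_preimage Q : biinfinite Q -> exists2 P, biinfinite P & phi P = Q.
Proof.
move=> bQ; have [P iP phiP] := phi_surj bQ; exists P => //.
by apply: phi_biinfinite_inv; rewrite ?phiP.
Qed.

Lemma phi_le M P : infinite_rank M -> biinfinite P ->
  le_proj M P <-> le_proj (phi M) (phi P).
Proof.
move=> iM bP; have bP' := phi_biinfinite bP; split=> MP.
  have [R iR phiR] := phi_surj bP'.2; apply/orth_compl_le; rewrite -phiR.
  apply/(phi_orth iR iM) => x; rewrite -MP; move: (M x).
  by apply/(phi_orth iR bP); rewrite phiR; exact: orth_compl bP'.
apply/orth_compl_le/(phi_orth bP.2 iM) => x; rewrite -MP; move: (phi M x).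
by apply/(phi_orth bP.2 bP); exact: orth_compl bP.
Qed.

Lemma phi_inj P Q : biinfinite P -> biinfinite Q -> phi P = phi Q -> P = Q.
Proof.
move=> bP bQ phiPQ; apply: (le_proj_anti bP bQ).
  by apply/(phi_le bP bQ); rewrite phiPQ; exact: le_proj_refl (phi_infinite bQ).
by apply/(phi_le bQ bP); rewrite phiPQ; exact: le_proj_refl (phi_infinite bQ).
Qed.

Lemma phi_compl P : biinfinite P -> phi (compl_proj P) = compl_proj (phi P).
Proof.
move=> bP; have bC := biinfinite_compl bP; have bP' := phi_biinfinite bP.
have iC' := phi_infinite bC; apply: (le_proj_anti iC' bP'.2).
  by apply: (orth_le_compl bP' iC'); apply/(phi_orth bC bP); exact: orth_compl bP.
have [R iR phiR] := phi_surj bP'.2; rewrite -phiR; apply/(phi_le iR bC).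
apply: (orth_le_compl bP iR); apply/(phi_orth iR bP); rewrite phiR.
exact: orth_compl bP'.
Qed.

Definition line_image M x u :=
  [/\ unit_vector u, phi M u = 0 & phi (add_line M x) = add_line (phi M) u].

(* [phi] is an order automorphism of the biinfinite projections, hence it
   preserves the covering relation. *)
Lemma exists_line_image M x : biinfinite M -> unit_vector x -> M x = 0 ->
  exists u, line_image M x u.
Proof.
move=> bM x_unit Mx; pose P := add_line M x.
have bP : biinfinite P by exact: biinfinite_add_line.
have [bM' bP'] := (phi_biinfinite bM, phi_biinfinite bP).
have phi_MP : le_proj (phi M) (phi P) by apply/(phi_le bM bP); exact: le_add_line bM Mx.
have nPM : ~ le_proj (phi P) (phi M).
  by move/(phi_le bP bM); exact: add_line_nle.
have [u [u_unit Pu Mu]] := exists_between bM' bP' phi_MP nPM.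
have [A bA phiA] := exists_biinfinite_preimage (biinfinite_add_line bM' u_unit Mu).
have AP : le_proj A P.
  by apply/(phi_le bA bP); rewrite phiA; exact: add_line_le bP' phi_MP Pu.
have MA : le_proj M A.
  by apply/(phi_le bM bA); rewrite phiA; exact: le_add_line bM' Mu.
exists u; split=> //; rewrite -phiA.
have [AM|-> //] := add_line_between bM bA x_unit Mx MA AP.
case: (add_line_nle u_unit Mu Mu); rewrite -phiA AM.
exact: le_proj_refl bM'.
Qed.

Lemma line_image_norm_ip M x y u v : biinfinite M -> unit_pair_in_kernel M x y ->
  line_image M x u -> line_image M y v -> `|ip u v| = `|ip x y|.
Proof.
move=> bM ker_xy [u_unit Mu phi_x] [v_unit Mv phi_y].
have [x_unit y_unit Mx My] := ker_xy; have bM' := phi_biinfinite bM.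
have ker_uv : unit_pair_in_kernel (phi M) u v by [].
have bP := biinfinite_add_line bM x_unit Mx; have bQ := biinfinite_add_line bM y_unit My.
have same_line : `|ip u v| ^+ 2 = 1 <-> `|ip x y| ^+ 2 = 1.
  split=> [/(add_line_eq u_unit v_unit Mu)|/(add_line_eq x_unit y_unit Mx) line_eq].
    by rewrite -phi_x -phi_y => /(phi_inj bP bQ)/(add_line_eq x_unit y_unit Mx).
  by apply/(add_line_eq u_unit v_unit Mu); rewrite -phi_x -phi_y line_eq.
have angle := phi_angle bP bQ; rewrite phi_x phi_y in angle.
apply/eqP; rewrite -(eqrXn2 (n := 2)) //; apply/eqP.
case: (add_line_angle_eq bM bM' ker_xy ker_uv angle) => [uv0|uv1|//]; last first.
  by rewrite uv1; apply/esym/same_line.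
case: (add_line_angle_eq bM' bM ker_uv ker_xy (angle_eq_sym angle)) => [xy0|xy1|-> //].
  by rewrite uv0 xy0.
by rewrite xy1; apply/same_line.
Qed.

Lemma line_image_le M N x u v : biinfinite M -> biinfinite N -> unit_vector x ->
  N x = 0 -> le_proj M N -> line_image M x u -> line_image N x v -> parallel u v.
Proof.
move=> bM bN x_unit Nx MN [u_unit Mu phi_M] [_ _ phi_N].
have Mx := le_proj_eq0 bM bN MN Nx; have MN' := (phi_le bM bN).1 MN.
have bP := biinfinite_add_line bM x_unit Mx; have bQ := biinfinite_add_line bN x_unit Nx.
have [iM' iN'] := (phi_infinite bM, phi_infinite bN).
have PN : commuting (add_line M x) N.
  move=> z; rewrite /add_line (projectionD bN) (projectionZ bN) Nx scaler0 MN.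
  by rewrite (le_proj_absorb bM bN MN) (projection_adj bN) Nx ip0r scale0r.
have Nu_eigen : phi N u = ip (phi N u) u *: u.
  have := phi_commuting bP bN PN u; rewrite phi_M add_line_self // /add_line.
  by rewrite (le_proj_absorb iM' iN' MN') Mu add0r.
have Nu0 : phi N u = 0.
  have [//|Nu] :=
    idempotent_eigenvector (projection_linear iN') (projection_idem iN') Nu_eigen.
  case: (add_line_nle x_unit Mx Nx); apply/(phi_le bP bN); rewrite phi_M.
  exact: add_line_le iN' MN' Nu.
have PQ : le_proj (add_line M x) (add_line N x).
  apply: (add_line_le bQ); last exact: add_line_self.
  exact: le_proj_trans MN (le_add_line bN Nx).
have := (phi_le bP bQ).1 PQ u; rewrite phi_M phi_N add_line_self // /add_line Nu0 add0r.
by move/esym; apply: parallel_neq0; exact: unit_vector_neq0.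
Qed.

Lemma line_image_parallel M N x u v : biinfinite M -> biinfinite N -> unit_vector x ->
  M x = 0 -> N x = 0 -> line_image M x u -> line_image N x v -> parallel u v.
Proof.
move=> bM bN x_unit Mx Nx img_u img_v.
have [M' [N' [S [[bM' M'M M'S] [bN' N'N N'S] bS S_eq0]]]] :=
  exists_biinfinite_bound bM bN.
have Sx := S_eq0 x Mx Nx.
have [w img_w] := exists_line_image bS x_unit Sx.
have [u' img_u'] := exists_line_image bM' x_unit (le_proj_eq0 bM' bS M'S Sx).
have [v' img_v'] := exists_line_image bN' x_unit (le_proj_eq0 bN' bS N'S Sx).
have u'u := line_image_le bM' bM x_unit Mx M'M img_u' img_u.
have u'w := line_image_le bM' bS x_unit Sx M'S img_u' img_w.
have v'w := line_image_le bN' bS x_unit Sx N'S img_v' img_w.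
have v'v := line_image_le bN' bN x_unit Nx N'N img_v' img_v.
exact: parallel_trans (parallel_trans (parallel_sym u'u) u'w)
  (parallel_trans (parallel_sym v'w) v'v).
Qed.

Lemma line_image_of_parallel M x u v :
  biinfinite M -> unit_vector u -> line_image M x v -> parallel u v -> line_image M x u.
Proof.
move=> bM u_unit [v_unit Mv phi_v] uv; have [c _ u_eq] := uv.
have Mu : phi M u = 0 by rewrite u_eq (projectionZ (phi_infinite bM)) Mv scaler0.
by split=> //; rewrite phi_v; apply/esym/add_line_eq => //; exact: parallel_unit.
Qed.

Lemma exists_infinite_line_map : exists chi : H -> H,
  (forall M x, biinfinite M -> unit_vector x -> M x = 0 -> line_image M x (chi x)) /\
  (forall x y, unit_vector x -> unit_vector y -> `|ip (chi x) (chi y)| = `|ip x y|).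
Proof.
have /choice[chi chiP] x : exists u, unit_vector x ->
    forall M, biinfinite M -> M x = 0 -> line_image M x u.
  have [x_unit|not_unit] := pselect (unit_vector x); last by exists 0.
  have [N [bN _ /(_ x (mem_head _ _)) Nx]] := exists_biinfinite_le [:: x] infinite_dim.
  have [u img_u] := exists_line_image bN x_unit Nx; exists u => _ M bM Mx.
  have [v img_v] := exists_line_image bM x_unit Mx; have [u_unit _ _] := img_u.
  apply: (line_image_of_parallel bM u_unit img_v).
  exact: (line_image_parallel bN bM x_unit Nx Mx img_u img_v).
exists chi; split=> [M x bM x_unit Mx|x y x_unit y_unit]; first exact: chiP.
have [M [bM _ M_eq0]] := exists_biinfinite_le [:: x; y] infinite_dim.
have Mx : M x = 0 by apply: M_eq0; rewrite !inE eqxx.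
have My : M y = 0 by apply: M_eq0; rewrite !inE eqxx orbT.
have img_x := chiP x x_unit M bM Mx; have img_y := chiP y y_unit M bM My.
by apply: (line_image_norm_ip bM _ img_x img_y).
Qed.

Section Implementer.
Variables (chi V Vs : H -> H) (s : K -> K).
Hypothesis chiP : forall M x, biinfinite M -> unit_vector x -> M x = 0 ->
  line_image M x (chi x).
Hypothesis isoV : semilinear_isometry s V.
Hypothesis V_chi : forall x, unit_vector x -> exists c, V x = c *: chi x.
Hypothesis adjV : adjoint_pair s V Vs.

Let linV : semilinear s V := isometry_semilinear isoV.
Let s_aut : scalar_aut s := semilinear_aut linV.

Lemma phi_fixes_image P x : biinfinite P -> P x = x -> phi P (V x) = V x.
Proof.
move=> bP Px; have projP' := infinite_rank_projection (phi_infinite bP).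
have [->|/exists_unit[a a_gt0 u_unit]] := eqVneq x 0.
  by rewrite (semilinear0 linV) (projection0 projP').
have Pu : P (a *: x) = a *: x by rewrite (projectionZ bP) Px.
have [chi_unit chi_sub] :=
  chiP (biinfinite_sub_line bP u_unit Pu) u_unit (sub_line_self u_unit Pu).
rewrite sub_lineK => phiP; have phi_chi := add_line_self chi_unit chi_sub.
rewrite -phiP in phi_chi.
have sa_neq0 : s a != 0 by rewrite -normr_eq0 (norm_scalar_aut s_aut) normr_eq0 gt_eqF.
apply: (scalerI sa_neq0); rewrite -(projectionZ projP') -(semilinearZ linV).
by have [c ->] := V_chi u_unit; rewrite (projectionZ projP') phi_chi.
Qed.

Lemma phi_intertwines P x : biinfinite P -> phi P (V x) = V (P x).
Proof.
move=> bP; have projP' := infinite_rank_projection (phi_infinite bP).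
have bC := biinfinite_compl bP.
have phi_PV : phi P (V (P x)) = V (P x).
  by apply: phi_fixes_image; rewrite ?(projection_idem bP).
have phi_CV : phi P (V (compl_proj P x)) = 0.
  have /(phi_fixes_image bC) : compl_proj P (compl_proj P x) = compl_proj P x.
    exact: projection_idem bC _.
  rewrite phi_compl // {1}/compl_proj; move: (V _) => v fixed_v.
  by rewrite -[LHS](subKr v) fixed_v subrr.
rewrite {1}(proj_compl_decomp P x) (semilinearD linV) (projectionD projP').
by rewrite phi_PV phi_CV addr0.
Qed.

Lemma exists_line_preimage w : unit_vector w ->
  exists x c, unit_vector x /\ chi x = c *: w.
Proof.
move=> w_unit.
have [T [bT _ /(_ w (mem_head _ _)) Tw]] := exists_biinfinite_le [:: w] infinite_dim.
have [M bM phiM] := exists_biinfinite_preimage bT.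
have [P bP phiP] := exists_biinfinite_preimage (biinfinite_add_line bT w_unit Tw).
have MP : le_proj M P.
  by apply/(phi_le bM bP); rewrite phiM phiP; exact: le_add_line bT Tw.
have nPM : ~ le_proj P M.
  by move/(phi_le bP bM); rewrite phiM phiP; exact: add_line_nle.
have [x [x_unit Px Mx]] := exists_between bM bP MP nPM.
have [chi_unit chi_M phi_x] := chiP bM x_unit Mx.
have bA := biinfinite_add_line bM x_unit Mx.
have := (phi_le bA bP).1 (add_line_le bP MP Px) (chi x).
rewrite phi_x phiP add_line_self // {1}/add_line -phiM chi_M add0r => chi_eq.
by exists x, (ip (chi x) w).
Qed.

Lemma implementer_surj y : exists x, y = V x.
Proof.
have [->|/exists_unit[a _ w_unit]] := eqVneq y 0.
  by exists 0; rewrite (semilinear0 linV).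
have [x [c [x_unit chi_x]]] := exists_line_preimage w_unit.
have [d Vx] := V_chi x_unit; rewrite chi_x !scalerA in Vx.
have dca_neq0 : d * c * a != 0.
  apply: contra_eq_neq x_unit => dca0; rewrite -(isometry_norm isoV) Vx dca0.
  by rewrite scale0r ip0l eq_sym oner_neq0.
exists (s (d * c * a)^-1 *: x).
by rewrite (semilinearZ linV) (scalar_autK s_aut) Vx scalerA mulVf // scale1r.
Qed.

Lemma implementer_adjointK : cancel Vs V.
Proof.
move=> y; apply: ip_injl => z; have [x ->] := implementer_surj z.
by rewrite ipC [RHS]ipC (semilinear_isometry_ip isoV) adjV.
Qed.

Section FiniteCorank.
Variable P : H -> H.
Hypothesis iP : infinite_rank P.

Let projP' : is_projection ip (phi P) := phi_infinite iP.

Definition pullback (x : H) := Vs (phi P (V x)).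

Lemma image_pullback x : V (pullback x) = phi P (V x).
Proof. exact: implementer_adjointK. Qed.

Lemma pullback_linear : semilinear id pullback.
Proof.
apply: is_linear_semilinear => a x y; apply: (semilinear_isometry_inj isoV).
rewrite image_pullback !(semilinearP linV) !image_pullback.
by rewrite (projectionD projP') (projectionZ projP').
Qed.

Lemma pullback_idem x : pullback (pullback x) = pullback x.
Proof.
by apply: (semilinear_isometry_inj isoV); rewrite !image_pullback (projection_idem projP').
Qed.

Lemma pullback_commuting R : biinfinite R -> commuting R P -> commuting R pullback.
Proof.
move=> bR commR x; apply: (semilinear_isometry_inj isoV).
rewrite image_pullback -!(phi_intertwines _ bR) image_pullback.
exact: phi_commuting bR iP commR _.
Qed.

Let pullback_on_range :
    (forall x, pullback (P x) = 0) \/ (forall x, pullback (P x) = P x) :=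
  commutant_on_range iP pullback_linear pullback_idem pullback_commuting.

Let pullback_on_kernel : (forall x, pullback (compl_proj P x) = 0) \/
    (forall x, pullback (compl_proj P x) = compl_proj P x) :=
  commutant_on_kernel iP pullback_linear pullback_idem pullback_commuting.

Lemma infinite_corank_of_pullback : (forall x, pullback (P x) = 0) ->
  infinite_rank (compl_proj P).
Proof.
move=> pullP0; split=> [|l]; first exact: compl_proj_projection iP.
have [v [Pv v_unit vl]] := (phi_infinite iP).2 (map V l).
have [w v_eq] := implementer_surj v.
have w_unit : unit_vector w by rewrite /unit_vector -(isometry_norm isoV) -v_eq.
have pull_w : pullback w = w.
  by apply: (semilinear_isometry_inj isoV); rewrite image_pullback -v_eq.
have pull_compl : pullback (compl_proj P w) = w.
  rewrite -[RHS]pull_w {2}(proj_compl_decomp P w) (semilinearD pullback_linear).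
  by rewrite pullP0 add0r.
exists w; split=> // [|y yl].
  case: pullback_on_kernel => pullC; last by rewrite -pullC.
  by case/eqP: (unit_vector_neq0 w_unit); rewrite -pull_compl pullC.
apply: (can_inj (scalar_autK s_aut)).
by rewrite -(semilinear_isometry_ip isoV) -v_eq vl ?map_f // (scalar_aut0 s_aut).
Qed.

Lemma phi_id_inv : (forall x, phi P x = x) -> forall x, P x = x.
Proof.
move=> phiP x; have [W [[_ _ surjW] WT]] := phi_angle iP iP.
have [y ->] := surjW x; have := WT y; rewrite /= !phiP => ->.
by rewrite !(projection_idem iP).
Qed.

Lemma phi_intertwines_cofinite x : ~ infinite_rank (compl_proj P) -> phi P (V x) = V (P x).
Proof.
move=> finite_corank; rewrite -image_pullback; congr V.
have [/infinite_corank_of_pullback //|pullP] := pullback_on_range.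
rewrite {1}(proj_compl_decomp P x) (semilinearD pullback_linear) pullP.
have [->|pullC] := pullback_on_kernel; first by rewrite addr0.
rewrite pullC -proj_compl_decomp; apply/esym/phi_id_inv => y.
have [z ->] := implementer_surj y; rewrite -image_pullback {1}(proj_compl_decomp P z).
by rewrite (semilinearD pullback_linear) pullP pullC -proj_compl_decomp.
Qed.

End FiniteCorank.

Lemma phi_implemented P : infinite_rank P -> phi P = V \o P \o Vs.
Proof.
move=> iP; apply/funext => y /=; rewrite -{1}(implementer_adjointK y).
have [iC|nC] := pselect (infinite_rank (compl_proj P)).
  by apply: phi_intertwines.
exact: phi_intertwines_cofinite.
Qed.

End Implementer.

Theorem infinite_rank_wigner : exists s U Us, [/\ semilinear_isometry s U,
  forall y, exists x, y = U x, adjoint_pair s U Us &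
  forall P, infinite_rank P -> phi P = U \o P \o Us].
Proof.
have [chi [chiP chi_norm_ip]] := exists_infinite_line_map.
have [s [V [isoV V_chi]]] := wigner chi_norm_ip; have [Vs adjV] := exists_adjoint isoV.
exists s, V, Vs; split=> //; first exact: implementer_surj chiP isoV V_chi.
exact: phi_implemented chiP isoV V_chi adjV.
Qed.

End InfiniteRank.
End HilbertSpace.

Theorem mainTheorem1 (R : realType) (b : bool) (H : lmodType (scal R b))
    (ip : H -> H -> scal R b) (hH : is_hilbert (cj R b) ip) :
  (forall (n : nat) (phi : (H -> H) -> (H -> H)),
     dim_ge H n ->
     (forall P, proj_rank ip n P -> proj_rank ip n (phi P)) ->
     (forall P Q, proj_rank ip n P -> proj_rank ip n Q ->
        angle_eq ip (phi P) (phi Q) P Q) ->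
     (n = 1%N \/ ~ has_dim H (n + n)%N) ->
     exists V Vs : H -> H,
       is_isometry ip V /\
       ((is_linear V /\ is_adjoint ip V Vs) \/
        (is_conj_linear (cj R b) V /\ is_conj_adjoint (cj R b) ip V Vs)) /\
       (forall P, proj_rank ip n P -> phi P = V \o P \o Vs))
  /\
  (inf_dim H ->
   forall phi : (H -> H) -> (H -> H),
     (forall P, proj_inf_rank ip P -> proj_inf_rank ip (phi P)) ->
     (forall Q, proj_inf_rank ip Q -> exists P, proj_inf_rank ip P /\ phi P = Q) ->
     (forall P Q, proj_inf_rank ip P -> proj_inf_rank ip Q ->
        angle_eq ip (phi P) (phi Q) P Q) ->
     exists U Us : H -> H,
       ((h_unitary ip U /\ is_adjoint ip U Us) \/
        (h_antiunitary (cj R b) ip U /\ is_conj_adjoint (cj R b) ip U Us)) /\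
       (forall P, proj_inf_rank ip P -> phi P = U \o P \o Us)).
Proof.
have [ipP ip_complete] := hH; have cK := conj_field_scal R b.
split=> [n phi _ phi_rank phi_angle dimH|infH phi phi_infinite phi_surj phi_angle].
  have [s [V [Vs [isoV adjV phiE]]]] :=
    finite_rank_wigner cK ipP ip_complete phi_rank phi_angle dimH.
  have [linV normV] := isoV; exists V, Vs; split=> //; split=> //.
  exact: adjoint_pair_cases (semilinear_aut linV) linV adjV.
have infP := proj_inf_rankP cK ipP.
have [|||s [U [Us [[linU normU] surjU adjU phiE]]]] :=
    infinite_rank_wigner cK ipP ip_complete (phi := phi) _ _ _
      (infinite_rank_id cK ipP infH).
- by move=> P /infP/phi_infinite/infP.
- by move=> Q /infP/phi_surj[P [/infP iP phiP]]; exists P.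
- by move=> P Q /infP iP /infP; exact: phi_angle.
exists U, Us; split=> [|P /infP]; last exact: phiE.
by case: (adjoint_pair_cases (semilinear_aut linU) linU adjU) => -[]; [left | right].
Qed.
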